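(* Let $\mathcal{C}(\mathcal{Z})$ be the discrete cluster category associated to an admissible subset $\mathcal{Z}\subseteq S^1$ with limit points $a_1<\dots<a_n$. There is an isomorphism of lattices $$NNC_n\cong\mathrm{Thick}(\mathcal{C}(\mathcal{Z})).$$ Under this isomorphism a non-exhaustive non-crossing partition $\mathcal{P}$ of $[n]$ corresponds to the subcategory $$\langle\mathcal{P}\rangle=\mathrm{add}\,\Big\{\{y_0,y_1\}\text{ arc of }\mathcal{Z}\;\Big|\;y_0,y_1\in\bigcup_{i\in B}(a_i,a_{i+1})\text{ for some }B\in\mathcal{P}\Big\}.$$
   Context: **Combinatorial setting.** $\mathbb{K}$ is a field. $S^1$ is the unit circle with anti-clockwise cyclic order: for pairwise distinct $x,y,z\in S^1$, $x<y<z$ means that going anti-clockwise one meets first $x$, then $y$, then $z$; for $m\ge 3$, $x_1<\dots<x_m$ means $x_i<x_{i+1}<x_{i+2}$ for all $i$ (indices modulo $m$). $\mathcal{Z}\subseteq S^1$ is admissible: discrete, infinite, with set of limit points $L(\mathcal{Z})=\overline{\mathcal{Z}}\setminus\mathcal{Z}$ ($\overline{\mathcal{Z}}$ the topological closure) finite of cardinality $n\geq 1$, every limit point being a two-sided limit point. The limit points are $a_1<\dots<a_n$, indices modulo $n$ (so $a_{n+1}=a_1$). For $a,b\in\overline{\mathcal{Z}}$, $(a,b)=\{c\in\overline{\mathcal{Z}}\mid a<c<b\}$ (for $n=1$, $(a_1,a_2)$ means $\mathcal{Z}$). Each $z\in\mathcal{Z}$ has an immediate successor $z^+$ and predecessor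 $z^-$ in $\mathcal{Z}$ (anti-clockwise, resp. clockwise neighbour). An arc of $\mathcal{Z}$ is a 2-element subset $\{z_0,z_1\}\subseteq\mathcal{Z}$ with $z_1\notin\{z_0^-,z_0,z_0^+\}$. Arcs $\{y_0,y_1\},\{y_0',y_1'\}$ cross if $y_0<y_0'<y_1<y_1'$ or $y_0<y_1'<y_1<y_0'$. **The category.** $\mathcal{C}(\mathcal{Z})$ is the discrete cluster category of Igusa–Todorov: a $\mathbb{K}$-linear, 2-Calabi–Yau, Krull–Schmidt triangulated category with suspension $\Sigma$ whose non-zero indecomposable objects correspond to arcs of $\mathcal{Z}$ (same notation for arc and object), with: - $\Sigma\{y_0,y_1\}=\{y_0^-,y_1^-\}$; - $\mathrm{Hom}(\{y_0,y_1\},\Sigma\{y_0',y_1'\})=\mathbb{K}$ if the arcs $\{y_0,y_1\}$ and $\{y'_0,y'_1\}$ cross, and $0$ otherwise; - a non-zero morphism $\{y_0,y_1\}\to\{y_0',y_1'\}$ with $y_0<y_0'^+<y_1<y_1'^+$ factors through an indecomposable $S$ iff $S=\{s_0,s_1\}$ with $y_0\le s_0\le y_0'$ and $y_1\le s_1\le y_1'$; - if $y_0<y_0'<y_1<y_1'$, every non-zero $f:\{y_0,y_1\}\to\Sigma\{y_0',y_1'\}$ sits in a triangle $\{y_0',y_1'\}\to X\oplus Z\to\{y_0,y_1\}\xrightarrow{f}\Sigma\{y_0',y_1'\}$ with $X=\{y_0,y_0'\}$, $Z=\{y_1,y_1'\}$ (read as $0$ when not an arc); the components of the first two maps to and from $X$,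 $Z$ are non-zero when the corresponding objects are non-zero. All subcategories are full and closed under direct sums and summands; $\mathrm{add}(\mathcal{Y})$ is the smallest such subcategory containing the set of arcs $\mathcal{Y}$ (in particular $\mathrm{add}(\varnothing)=0$). **Thick subcategories.** A full subcategory is thick if it is closed under cones, direct summands, $\Sigma$ and $\Sigma^{-1}$. $\mathrm{Thick}(\mathcal{C}(\mathcal{Z}))$ is the lattice of thick subcategories under inclusion. **$NNC_n$.** A non-exhaustive non-crossing partition of $[n]=\{1,\dots,n\}$ is a (possibly empty) collection $\mathcal{P}=\{B_m\mid m\in I\}$ of non-empty pairwise disjoint subsets (blocks) of $[n]$, not required to cover $[n]$, such that whenever $1\le i<k<j<l\le n$ with $i,j\in B_{m_1}$ and $k,l\in B_{m_2}$, then $m_1=m_2$. $NNC_n$ is the set of these, ordered by $\mathcal{P}\le\mathcal{P}'$ iff every block of $\mathcal{P}$ is contained in some block of $\mathcal{P}'$; it is a lattice.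
   Formalization: The limit points a_1<…<a_n are required to be in anti-clockwise order for all i<j<k, not only for consecutive indices modulo n, since for n≥5 the consecutive condition also admits enumerations winding several times around the circle, for which the claim fails. *)

(* Defs.v *)
From HB Require Import structures.
From mathcomp Require Import all_boot all_order all_algebra.

Set Implicit Arguments.
Unset Strict Implicit.
Unset Printing Implicit Defensive.

Import Order.TTheory GRing.Theory Num.Theory.

Section NNC.
Local Open Scope set_scope.
Local Open Scope order_scope.
Variable n : nat.
Implicit Types (P Q : {set {set 'I_n}}).

Definition noncrossing P : bool :=
  [forall B1 in P, forall B2 in P,
   forall i : 'I_n, forall k : 'I_n, forall j : 'I_n, forall l : 'I_n,
    [&& (i < k)%N, (k < j)%N, (j < l)%N,
        i \in B1, j \in B1, k \in B2 & l \in B2] ==> (B1 == B2)].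

Definition is_nnc P : bool :=
  [&& set0 \notin P, trivIset P & noncrossing P].

Record nnc := NNC { nnc_blocks :> {set {set 'I_n}}; nncP : is_nnc nnc_blocks }.

HB.instance Definition _ := [isSub for nnc_blocks].
HB.instance Definition _ := [Finite of nnc by <:].

Lemma noncrossingP P :
  reflect (forall B1 B2 : {set 'I_n}, B1 \in P -> B2 \in P ->
             forall i k j l : 'I_n, (i < k)%N -> (k < j)%N -> (j < l)%N ->
             i \in B1 -> j \in B1 -> k \in B2 -> l \in B2 -> B1 = B2)
          (noncrossing P).
Proof.
apply: (iffP idP) => [H B1 B2 B1P B2P i k j l ik kj jl iB jB kB lB|H].
  move/forall_inP: H => /(_ _ B1P)/forall_inP/(_ _ B2P).
  move=> /forallP/(_ i)/forallP/(_ k)/forallP/(_ j)/forallP/(_ l).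
  by rewrite ik kj jl iB jB kB lB => /eqP.
apply/forall_inP => B1 B1P; apply/forall_inP => B2 B2P.
apply/forallP => i; apply/forallP => k; apply/forallP => j; apply/forallP => l.
apply/implyP => /and5P[ik kj jl iB /and3P[jB kB lB]].
by apply/eqP; apply: (H _ _ _ _ i k j l).
Qed.

Lemma nnc_block_eq (P : nnc) (B C : {set 'I_n}) x :
  B \in (P : {set {set 'I_n}}) -> C \in (P : {set {set 'I_n}}) ->
  x \in B -> x \in C -> B = C.
Proof.
have /and3P[_ /trivIsetP tP _] := nncP P => BP CP xB xC.
apply/eqP; apply: contraT => /(tP _ _ BP CP)/pred0P/(_ x) /=.
by rewrite xB xC.
Qed.

Definition nnc_le (P Q : nnc) : bool :=
  [forall B in nnc_blocks P, exists C in nnc_blocks Q, B \subset C].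

Lemma nnc_leP (P Q : nnc) :
  reflect (forall B, B \in nnc_blocks P ->
             exists2 C, C \in nnc_blocks Q & B \subset C)
          (nnc_le P Q).
Proof. by apply: (iffP forall_inP) => H B /H /exists_inP. Qed.

Lemma nnc_le_refl : reflexive nnc_le.
Proof. by move=> P; apply/nnc_leP => B BP; exists B. Qed.

Lemma nnc_le_trans : transitive nnc_le.
Proof.
move=> Q P S /nnc_leP PQ /nnc_leP QS; apply/nnc_leP => B /PQ[C /QS[D DS CD] BC].
by exists D => //; apply: subset_trans CD.
Qed.

Lemma nnc_le_sub (P Q : nnc) :
  nnc_le P Q -> nnc_le Q P -> nnc_blocks P \subset nnc_blocks Q.
Proof.
move=> /nnc_leP PQ /nnc_leP QP; apply/subsetP => B BP.
have [C CQ BC] := PQ _ BP; have [D DP CD] := QP _ CQ.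
have B0 : B != set0.
  by apply: contraTneq BP => ->; case/and3P: (nncP P).
have [x xB] := set0Pn _ B0.
have eBD : B = D.
  by apply: (nnc_block_eq BP DP xB); apply: (subsetP CD); apply: (subsetP BC).
suff -> : B = C by [].
by apply/eqP; rewrite eqEsubset BC eBD.
Qed.

Lemma nnc_le_anti : antisymmetric nnc_le.
Proof.
move=> P Q /andP[PQ QP]; apply: val_inj; apply/eqP.
by rewrite eqEsubset !nnc_le_sub.
Qed.

Fact nnc_display : Order.disp_t. Proof. exact: Order.Disp tt tt. Qed.

HB.instance Definition _ :=
  Order.Le_isPOrder.Build nnc_display nnc nnc_le_refl nnc_le_anti nnc_le_trans.

Definition nnc_meet_blocks P Q : {set {set 'I_n}} :=
  [set B :&: C | B in P, C in Q] :\ set0.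

Lemma nnc_meet_subproof (P Q : nnc) : is_nnc (nnc_meet_blocks P Q).
Proof.
apply/and3P; split; first by rewrite !inE eqxx.
  apply/trivIsetP => A A'.
  move=> /setD1P[_ /imset2P[B C BP CQ ->]] /setD1P[_ /imset2P[B' C' BP' CQ' ->]].
  apply: contraR => /pred0Pn[x /andP[]] /=.
  rewrite !inE => /andP[xB xC] /andP[xB' xC'].
  by rewrite (nnc_block_eq BP BP' xB xB') (nnc_block_eq CQ CQ' xC xC').
have /and3P[_ _ /noncrossingP ncP] := nncP P.
have /and3P[_ _ /noncrossingP ncQ] := nncP Q.
apply/noncrossingP => A A'.
move=> /setD1P[_ /imset2P[B C BP CQ ->]] /setD1P[_ /imset2P[B' C' BP' CQ' ->]].
move=> i k j l ik kj jl; rewrite !inE.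
move=> /andP[iB iC] /andP[jB jC] /andP[kB kC] /andP[lB lC].
rewrite (ncP _ _ BP BP' i k j l) //.
by rewrite (ncQ _ _ CQ CQ' i k j l).
Qed.

Definition nnc_meet (P Q : nnc) : nnc := NNC (nnc_meet_subproof P Q).

Lemma nnc_meetP (P Q S : nnc) :
  (P <= nnc_meet Q S) = (P <= Q) && (P <= S).
Proof.
apply/idP/andP => [/nnc_leP H|[/nnc_leP HQ /nnc_leP HS]].
  by split; apply/nnc_leP => B /H[_ /setD1P[_ /imset2P[C D CQ DS ->]]];
    rewrite subsetI => /andP[BC BD]; [exists C|exists D].
apply/nnc_leP => B BP; have [C CQ BC] := HQ _ BP; have [D DS BD] := HS _ BP.
have B0 : B != set0.
  by apply: contraTneq BP => ->; case/and3P: (nncP P).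
exists (C :&: D); last by rewrite subsetI BC BD.
apply/setD1P; split; last by apply/imset2P; exists C D.
have [x xB] := set0Pn _ B0; apply/set0Pn; exists x.
by rewrite inE (subsetP BC) ?(subsetP BD).
Qed.

Lemma nnc_top_subproof : is_nnc ([set [set: 'I_n]] :\ set0).
Proof.
apply/and3P; split; first by rewrite !inE eqxx.
  by apply/trivIsetP => A B /setD1P[_ /set1P->] /setD1P[_ /set1P->]; rewrite eqxx.
by apply/noncrossingP => A B /setD1P[_ /set1P->] /setD1P[_ /set1P->].
Qed.

Definition nnc_top : nnc := NNC nnc_top_subproof.

Lemma nnc_lex1 (P : nnc) : P <= nnc_top.
Proof.
apply/nnc_leP => B BP; exists setT; last exact: subsetT.
apply/setD1P; split; last by rewrite inE.
suff /set0Pn[x xB] : B != set0 by apply/set0Pn; exists x; rewrite inE.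
by apply: contraTneq BP => ->; case/and3P: (nncP P).
Qed.

Definition nnc_join (P Q : nnc) : nnc :=
  \big[nnc_meet/nnc_top]_(U : nnc | (P <= U) && (Q <= U)) U.

Lemma nnc_joinP (P Q S : nnc) : (nnc_join P Q <= S) = (P <= S) && (Q <= S).
Proof.
have le_join (T : nnc) :
    (forall U, P <= U -> Q <= U -> T <= U) -> T <= nnc_join P Q.
  move=> H; rewrite /nnc_join; elim/big_ind: _ => [|x y Tx Ty|U /andP[PU QU]].
  - exact: nnc_lex1.
  - by rewrite nnc_meetP Tx.
  - exact: H.
have join_le (U : nnc) : P <= U -> Q <= U -> nnc_join P Q <= U.
  move=> PU QU; rewrite /nnc_join -big_filter.
  have : U \in [seq V <- index_enum nnc | (P <= V) && (Q <= V)].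
    by rewrite mem_filter PU QU mem_index_enum.
  elim: [seq _ <- _ | _] => // V s IHs; rewrite inE big_cons.
  have := lexx (nnc_meet V (\big[nnc_meet/nnc_top]_(j <- s) j)).
  rewrite {1}nnc_meetP => /andP[leV les] /predU1P[-> //|/IHs].
  exact: le_trans.
apply/idP/andP => [H|[]]; last exact: join_le.
by split; apply: le_trans H; apply: le_join.
Qed.

HB.instance Definition _ :=
  Order.POrder_MeetJoin_isLattice.Build nnc_display nnc nnc_meetP nnc_joinP.

End NNC.

From mathcomp Require Import all_classical all_reals all_analysis.
Import numFieldNormedType.Exports.

Local Open Scope ring_scope.
Local Open Scope classical_set_scope.

Record linear_category (K : fieldType) := LinearCategory {
  Ob :> Type;
  Hom : Ob -> Ob -> lmodType K;
  idm : forall X, Hom X X;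
  compm : forall X Y Z, Hom Y Z -> Hom X Y -> Hom X Z;
  comp_idl : forall X Y (f : Hom X Y), compm (idm Y) f = f;
  comp_idr : forall X Y (f : Hom X Y), compm f (idm X) = f;
  comp_assoc : forall X Y Z W (h : Hom Z W) (g : Hom Y Z) (f : Hom X Y),
    compm h (compm g f) = compm (compm h g) f;
  comp_linl : forall X Y Z (f : Hom X Y), linear (fun g : Hom Y Z => compm g f);
  comp_linr : forall X Y Z (g : Hom Y Z), linear (fun f : Hom X Y => compm g f)
}.

Notation "g \*c f" := (compm g f) (at level 40, left associativity).

Section LinearCategory.
Variables (K : fieldType) (C : linear_category K).
Implicit Types X Y Z : C.

Definition is_iso X Y (f : Hom X Y) : Prop :=
  exists g : Hom Y X, g \*c f = idm X /\ f \*c g = idm Y.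

Definition isomorphic X Y : Prop := exists f : Hom X Y, is_iso f.

Definition is_zero X : Prop := idm X = 0.

(** [X] is the direct sum of the finite family [Y], with injections [i] and
    projections [p]; the empty family gives a zero object. *)
Definition is_dsum (I : finType) (Y : I -> C) X
    (i : forall k, Hom (Y k) X) (p : forall k, Hom X (Y k)) : Prop :=
  [/\ forall k, p k \*c i k = idm (Y k),
      forall k l, k <> l -> p k \*c i l = 0 &
      \sum_k (i k \*c p k) = idm X].

Definition dsum_of (I : finType) (Y : I -> C) X : Prop :=
  exists i p, is_dsum (Y := Y) (X := X) i p.

Definition pair_of X Y : bool -> C := fun b => if b then X else Y.

Definition has_finite_dsums : Prop :=
  forall m (Y : 'I_m -> C), exists X, dsum_of Y X.

Definition is_summand Y X : Prop := exists Y', dsum_of (pair_of Y Y') X.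

Definition indecomposable X : Prop :=
  ~ is_zero X /\
  forall Y Z, dsum_of (pair_of Y Z) X -> is_zero Y \/ is_zero Z.

(** The endomorphism ring of [X] is local: sums of non-units are non-units. *)
Definition local_end X : Prop :=
  ~ is_zero X /\
  forall f g : Hom X X, is_iso (f + g) -> is_iso f \/ is_iso g.

Definition krull_schmidt : Prop :=
  forall X, exists m (Y : 'I_m -> C),
    (forall k, local_end (Y k)) /\ dsum_of Y X.

Definition add_closed (T : set C) : Prop :=
  (forall m (Y : 'I_m -> C) X, dsum_of Y X -> (forall k, T (Y k)) -> T X) /\
  (forall X Y, is_summand Y X -> T X -> T Y).

Definition add_hull (A : set C) : set C :=
  [set X | forall T, add_closed T -> A `<=` T -> T X].

End LinearCategory.

Section TriangleAxioms.
Variables (K : fieldType) (C : linear_category K).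
Variables (S : C -> C) (Sm : forall X Y, {linear Hom X Y -> Hom (S X) (S Y)}).
Variable D : forall X Y Z : C, Hom X Y -> Hom Y Z -> Hom Z (S X) -> Prop.

Definition linear_functor : Prop :=
  (forall X, Sm X X (idm X) = idm (S X)) /\
  (forall X Y Z (g : Hom Y Z) (f : Hom X Y),
     Sm X Z (g \*c f) = Sm Y Z g \*c Sm X Y f).

Definition tr_iso : Prop :=
  forall X Y Z X' Y' Z'
    (u : Hom X Y) (v : Hom Y Z) (w : Hom Z (S X))
    (u' : Hom X' Y') (v' : Hom Y' Z') (w' : Hom Z' (S X'))
    (a : Hom X X') (b : Hom Y Y') (c : Hom Z Z'),
    is_iso a -> is_iso b -> is_iso c ->
    b \*c u = u' \*c a -> c \*c v = v' \*c b -> Sm X X' a \*c w = w' \*c c ->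
    D u v w -> D u' v' w'.

Definition tr_id : Prop :=
  forall X Z, is_zero Z -> D (idm X) (0 : Hom X Z) 0.

Definition tr_cone : Prop :=
  forall X Y (u : Hom X Y), exists Z (v : Hom Y Z) w, D u v w.

Definition tr_rotate : Prop :=
  forall X Y Z (u : Hom X Y) (v : Hom Y Z) (w : Hom Z (S X)),
    D u v w <-> D v w (- Sm X Y u).

Definition tr_morphism : Prop :=
  forall X Y Z X' Y' Z'
    (u : Hom X Y) (v : Hom Y Z) (w : Hom Z (S X))
    (u' : Hom X' Y') (v' : Hom Y' Z') (w' : Hom Z' (S X'))
    (a : Hom X X') (b : Hom Y Y'),
    D u v w -> D u' v' w' -> b \*c u = u' \*c a ->
    exists c : Hom Z Z', c \*c v = v' \*c b /\ Sm X X' a \*c w = w' \*c c.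

Definition tr_octahedron : Prop :=
  forall X Y Z X' Y' Z'
    (u : Hom X Y) (j : Hom Y Z') (k : Hom Z' (S X))
    (v : Hom Y Z) (l : Hom Z X') (i : Hom X' (S Y))
    (m : Hom Z Y') (q : Hom Y' (S X)),
    D u j k -> D v l i -> D (v \*c u) m q ->
    exists (f : Hom Z' Y') (g : Hom Y' X'),
      [/\ D f g (Sm Y Z' j \*c i), g \*c m = l, q \*c f = k,
          f \*c j = m \*c v & Sm X Y u \*c q = i \*c g].

End TriangleAxioms.

Record triangulated_category (K : fieldType) := TriangulatedCategory {
  tcat :> linear_category K;
  tcat_dsums : has_finite_dsums tcat;
  susp : tcat -> tcat;
  susp_mor : forall X Y, {linear Hom X Y -> Hom (susp X) (susp Y)};
  susp_functor : linear_functor susp_mor;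
  (* [susp] is an auto-equivalence with quasi-inverse [desusp]. *)
  susp_ff : forall X Y, bijective (susp_mor X Y);
  desusp : tcat -> tcat;
  susp_desusp : forall X, isomorphic (susp (desusp X)) X;
  triangle : forall X Y Z, Hom X Y -> Hom Y Z -> Hom Z (susp X) -> Prop;
  triangle_iso : tr_iso susp_mor triangle;
  triangle_id : tr_id triangle;
  triangle_cone : tr_cone triangle;
  triangle_rotate : tr_rotate susp_mor triangle;
  triangle_morphism : tr_morphism susp_mor triangle;
  triangle_octahedron : tr_octahedron susp_mor triangle
}.

Arguments susp {K t} X.
Arguments susp_mor {K t X Y}.
Arguments desusp {K t} X.
Arguments triangle {K t X Y Z} u v w.

(** A natural isomorphism Hom(X, Y) = Hom(Y, Sigma^2 X)^*, given as a pairing. *)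
Definition calabi_yau2 (K : fieldType) (C : triangulated_category K) : Prop :=
  exists cy : forall X Y : C,
      Hom X Y -> {linear Hom Y (susp (susp X)) -> K^o},
    [/\ forall X Y (g : Hom Y (susp (susp X))),
          linear (fun f : Hom X Y => cy X Y f g : K^o),
        forall X Y (phi : {linear Hom Y (susp (susp X)) -> K^o}),
          exists! f : Hom X Y, forall g, cy X Y f g = phi g,
        forall X Y Y' (h : Hom Y Y') (f : Hom X Y) (g : Hom Y' (susp (susp X))),
          cy X Y' (h \*c f) g = cy X Y f (g \*c h) &
        forall X' X Y (k : Hom X' X) (f : Hom X Y) (g : Hom Y (susp (susp X'))),
          cy X' Y (f \*c k) g = cy X Y f (susp_mor (susp_mor k) \*c g)].

(** Full subcategories are sets of objects; those closed under direct sums and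
    summands are automatically closed under isomorphism. *)

Definition is_thick (K : fieldType) (C : triangulated_category K) (T : set C) : Prop :=
  [/\ add_closed T,
      forall (X Y Z : C) (u : Hom X Y) (v : Hom Y Z) (w : Hom Z (susp X)),
        triangle u v w -> T X -> T Y -> T Z,
      forall X : C, T X -> T (susp X) &
      forall X : C, T X -> T (desusp X)].

Record thick (K : fieldType) (C : triangulated_category K) := Thick {
  thick_set :> set C;
  thickP : is_thick thick_set
}.

Section ThickLattice.
Variables (K : fieldType) (C : triangulated_category K).
Local Notation thick := (thick C).
Implicit Types T U V : thick.

HB.instance Definition _ := gen_eqMixin thick.
HB.instance Definition _ := gen_choiceMixin thick.

Definition thick_le T U : bool := `[< thick_set T `<=` thick_set U >].

Lemma thick_le_refl : reflexive thick_le.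
Proof. by move=> T; apply/asboolP. Qed.

Lemma thick_le_anti : antisymmetric thick_le.
Proof.
move=> [T hT] [U hU] /andP[/asboolP /= TU /asboolP /= UT].
have eTU : T = U by apply/seteqP.
by subst U; congr Thick; apply: Prop_irrelevance.
Qed.

Lemma thick_le_trans : transitive thick_le.
Proof.
move=> U T V /asboolP TU /asboolP UV; apply/asboolP.
exact: subset_trans UV.
Qed.

Fact thick_display : Order.disp_t. Proof. exact: Order.Disp tt tt. Qed.

HB.instance Definition _ := Order.isPOrder.Build thick_display thick
  (fun _ _ => erefl) thick_le_refl thick_le_anti thick_le_trans.

Lemma thick_bigcap_subproof (F : set thick) :
  is_thick (\bigcap_(T in F) thick_set T).
Proof.
split.
- split=> [m Y X dX TY T FT|X Y sYX TX T FT].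
    by have [[h _] _ _ _] := thickP T; apply: (h _ _ _ dX) => k; apply: TY.
  by have [[_ h] _ _ _] := thickP T; apply: (h _ _ sYX); apply: TX.
- move=> X Y Z u v w tr TX TY T FT; have [_ h _ _] := thickP T.
  by apply: (h _ _ _ _ _ _ tr); [apply: TX|apply: TY].
- by move=> X TX T FT; have [_ _ h _] := thickP T; apply/h/TX.
- by move=> X TX T FT; have [_ _ _ h] := thickP T; apply/h/TX.
Qed.

Definition thick_bigcap (F : set thick) : thick :=
  Thick (thick_bigcap_subproof F).

Definition thick_meet T U : thick := thick_bigcap [set T; U].

Definition thick_join T U : thick :=
  thick_bigcap [set V | (T <= V)%O /\ (U <= V)%O].

Lemma thick_meetP T U V : (T <= thick_meet U V)%O = (T <= U)%O && (T <= V)%O.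
Proof.
apply/asboolP/andP => [H|[/asboolP TU /asboolP TV]].
  by split; apply/asboolP => X /H; apply; [left|right].
by move=> X TX W [->|->]; [apply: TU|apply: TV].
Qed.

Lemma thick_joinP T U V : (thick_join T U <= V)%O = (T <= V)%O && (U <= V)%O.
Proof.
apply/asboolP/andP => [H|[TV UV]].
  by split; apply/asboolP => X TX; apply: H => W [/asboolP TW /asboolP UW];
    [apply: TW|apply: UW].
by move=> X; apply.
Qed.

HB.instance Definition _ := Order.POrder_isMeetSemilattice.Build
  thick_display thick thick_meetP.
HB.instance Definition _ := Order.POrder_isJoinSemilattice.Build
  thick_display thick thick_joinP.

End ThickLattice.

Section Circle.
Variable R : realType.
Implicit Types (x y z : R * R) (Z : set (R * R)).

Definition circle : set (R * R) := [set p | p.1 ^+ 2 + p.2 ^+ 2 = 1].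

Definition circle_pt (t : R) : R * R := (cos t, sin t).

(** x < y < z in the anti-clockwise cyclic order: the arguments of x, y, z can be
    chosen increasing within one full turn. *)
Definition cyc x y z : Prop :=
  exists t u v : R, [/\ t < u, u < v & v < t + 2 * pi] /\
    [/\ x = circle_pt t, y = circle_pt u & z = circle_pt v].

Definition cyc4 x y z w : Prop :=
  [/\ cyc x y z, cyc y z w, cyc z w x & cyc w x y].

(** x <= y <= z, i.e. y lies in the closed anti-clockwise interval [x, z]. *)
Definition cyc_le x y z : Prop := [\/ y = x, y = z | cyc x y z].

Definition two_sided Z a : Prop :=
  forall x, circle x -> x <> a ->
    (exists2 z, Z z & cyc x z a) /\ (exists2 z, Z z & cyc a z x).

Record admissible Z (n : nat) (a : 'I_n -> R * R) : Prop := Admissible {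
  adm_circle : Z `<=` circle;
  adm_discrete : Z `<=` isolated Z;
  adm_infinite : infinite_set Z;
  adm_n_gt0 : (0 < n)%N;
  adm_inj : injective a;
  adm_limit_points : range a = closure Z `\` Z;
  (* For 5 <= n, requiring this only for consecutive indices would also allow
     enumerations that wind around the circle several times. *)
  adm_cyclic : forall i j k : 'I_n,
    (i < j)%N -> (j < k)%N -> cyc (a i) (a j) (a k);
  adm_two_sided : forall i, two_sided Z (a i)
}.

Definition is_succ Z z w : Prop :=
  [/\ Z w, w <> z & forall u, Z u -> ~ cyc z u w].

Definition zsucc Z z : R * R := xget z [set w | is_succ Z z w].
Definition zpred Z z : R * R := xget z [set w | Z w /\ is_succ Z w z].

Definition is_arc Z (A : set (R * R)) : Prop :=
  exists z0 z1, [/\ Z z0, Z z1, A = [set z0; z1] &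
                    [/\ z1 <> zpred Z z0, z1 <> z0 & z1 <> zsucc Z z0]].

Definition cross (A B : set (R * R)) : Prop :=
  exists y0 y1 y0' y1', [/\ A = [set y0; y1], B = [set y0'; y1'] &
    cyc4 y0 y0' y1 y1' \/ cyc4 y0 y1' y1 y0'].

(** (a_i, a_{i+1}), which by convention is Z if n = 1, when a_{i+1} = a_i. *)
Definition interval_of Z n (a : 'I_n -> R * R) (i : 'I_n) : set (R * R) :=
  if n == 1%N then Z else [set c | closure Z c /\ cyc (a i) c (a (ordS i))].

End Circle.

(** The category is specified by its structure and the description of its
    indecomposable objects, morphisms and triangles in terms of arcs.
    [arc_obj A] is the object attached to the arc [A], and is zero if [A] is
    not an arc; this convention is used in [dcc_triangle]. *)

Record discrete_cluster_category (R : realType) (Z : set (R * R))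
    (K : fieldType) := DiscreteClusterCategory {
  dcc :> triangulated_category K;
  dcc_krull_schmidt : krull_schmidt dcc;
  dcc_calabi_yau : calabi_yau2 dcc;
  arc_obj : set (R * R) -> dcc;
  arc_obj_zero : forall A, ~ is_arc Z A -> is_zero (arc_obj A);
  arc_obj_indec : forall A, is_arc Z A -> indecomposable (arc_obj A);
  arc_obj_inj : forall A B, is_arc Z A -> is_arc Z B ->
    isomorphic (arc_obj A) (arc_obj B) -> A = B;
  arc_obj_surj : forall X, indecomposable X ->
    exists2 A, is_arc Z A & isomorphic X (arc_obj A);
  dcc_susp : forall y0 y1, is_arc Z [set y0; y1] ->
    isomorphic (susp (arc_obj [set y0; y1]))
               (arc_obj [set zpred Z y0; zpred Z y1]);
  dcc_hom_cross : forall A B, is_arc Z A -> is_arc Z B -> cross A B ->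
    exists phi : {linear K^o -> Hom (arc_obj A) (susp (arc_obj B))},
      bijective phi;
  dcc_hom_noncross : forall A B, is_arc Z A -> is_arc Z B -> ~ cross A B ->
    forall f : Hom (arc_obj A) (susp (arc_obj B)), f = 0;
  dcc_factor : forall y0 y1 y0' y1',
    is_arc Z [set y0; y1] -> is_arc Z [set y0'; y1'] ->
    cyc4 y0 (zsucc Z y0') y1 (zsucc Z y1') ->
    forall f : Hom (arc_obj [set y0; y1]) (arc_obj [set y0'; y1']), f <> 0 ->
    forall A, is_arc Z A ->
      ((exists (h : Hom (arc_obj A) (arc_obj [set y0'; y1']))
               (g : Hom (arc_obj [set y0; y1]) (arc_obj A)), f = h \*c g) <->
       (exists s0 s1, [/\ A = [set s0; s1], cyc_le y0 s0 y0' &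
                          cyc_le y1 s1 y1']));
  dcc_triangle : forall y0 y1 y0' y1',
    is_arc Z [set y0; y1] -> is_arc Z [set y0'; y1'] -> cyc4 y0 y0' y1 y1' ->
    forall f : Hom (arc_obj [set y0; y1]) (susp (arc_obj [set y0'; y1'])),
    f <> 0 ->
    let A (b : bool) := if b then [set y0; y0'] else [set y1; y1'] in
    exists (W : dcc)
           (i : forall b, Hom (arc_obj (A b)) W)
           (p : forall b, Hom W (arc_obj (A b)))
           (u : Hom (arc_obj [set y0'; y1']) W)
           (v : Hom W (arc_obj [set y0; y1])),
      [/\ is_dsum i p, triangle u v f &
          forall b, is_arc Z (A b) -> p b \*c u <> 0 /\ v \*c i b <> 0]
}.

Arguments arc_obj {R Z K} d A.

Definition partition_arcs (R : realType) (Z : set (R * R)) (n : nat)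
    (a : 'I_n -> R * R) (P : nnc n) : set (set (R * R)) :=
  [set A | exists y0 y1, [/\ A = [set y0; y1], is_arc Z A &
     exists2 B, B \in nnc_blocks P &
       (\bigcup_(i in [set` B]) interval_of Z a i) y0 /\
       (\bigcup_(i in [set` B]) interval_of Z a i) y1]].

Definition partition_subcat (R : realType) (Z : set (R * R)) (K : fieldType)
    (C : discrete_cluster_category Z K) (n : nat) (a : 'I_n -> R * R)
    (P : nnc n) : set C :=
  add_hull (arc_obj C @` partition_arcs Z a P).

Arguments partition_subcat {R Z K} C {n} a P.

(* Main.v *)
(* Cut open at its limit points, Z becomes the lexicographic product of
   {1, ..., n} with the integers, so that shifts and crossings of arcs are
   computed in coordinates (i, k).

   The arcs of a thick subcategory T are stable under shifts and, by the given
   triangles, under passing to the sides of two crossing arcs. Hence if T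
   contains an arc joining the i-th and the j-th interval, it contains all the
   arcs inside their union; being joined by an arc of T is symmetric and
   transitive, and its classes form a non-exhaustive non-crossing partition P
   with T = <P>.

   That <P> is closed under cones cannot be read off orthogonality to a set of
   objects, because arcs ending at limit points are missing from C(Z). An arc
   outside <P> is separated from <P> either by the arcs inside an interval that
   lies in no block, or by a "limit arc" joining two limit points and crossing
   no arc of P. The latter is replaced by the arcs whose endpoints tend to these
   two limit points: an object is orthogonal to the limit arc if every map from
   it to one of those arcs dies further along the sequence, and this property
   defines a thick subcategory. So <P> is an intersection of thick
   subcategories. *)
Require Import Defs.
From HB Require Import structures.
From mathcomp Require Import all_boot all_order all_algebra.
From mathcomp Require Import all_classical all_reals all_analysis.
From mathcomp Require Import ring lra zify.
Import numFieldNormedType.Exports.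

Set Implicit Arguments.
Unset Strict Implicit.
Unset Printing Implicit Defensive.

Import Order.TTheory GRing.Theory Num.Theory.

Local Open Scope ring_scope.
Local Open Scope classical_set_scope.

Local Notation Hom := Defs.Hom.

(** * Linear and triangulated categories *)

Section LinearCategoryTheory.
Variables (K : fieldType) (C : linear_category K).
Implicit Types X Y Z W : C.

Lemma compmDl X Y Z (g h : Hom Y Z) (f : Hom X Y) :
  (g + h) \*c f = g \*c f + h \*c f.
Proof. by have := comp_linl f 1 g h; rewrite /= !scale1r. Qed.

Lemma compmDr X Y Z (g : Hom Y Z) (f h : Hom X Y) :
  g \*c (f + h) = g \*c f + g \*c h.
Proof. by have := comp_linr g 1 f h; rewrite /= !scale1r. Qed.

Lemma comp0m X Y Z (f : Hom X Y) : (0 : Hom Y Z) \*c f = 0.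
Proof. by apply: (addIr (0 \*c f)); rewrite -compmDl !add0r. Qed.

Lemma compm0 X Y Z (g : Hom Y Z) : g \*c (0 : Hom X Y) = 0.
Proof. by apply: (addIr (g \*c 0)); rewrite -compmDr !add0r. Qed.

Lemma compmZl X Y Z a (g : Hom Y Z) (f : Hom X Y) :
  (a *: g) \*c f = a *: (g \*c f).
Proof. by have := comp_linl f a g 0; rewrite /= comp0m !addr0. Qed.

Lemma compmZr X Y Z a (g : Hom Y Z) (f : Hom X Y) :
  g \*c (a *: f) = a *: (g \*c f).
Proof. by have := comp_linr g a f 0; rewrite /= compm0 !addr0. Qed.

Lemma comp_suml (I : finType) X Y Z (F : I -> Hom Y Z) (f : Hom X Y) :
  (\sum_i F i) \*c f = \sum_i (F i \*c f).
Proof.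
exact: (big_morph (fun g => g \*c f) (fun g h => compmDl g h f) (comp0m Z f)).
Qed.

Lemma comp_sumr (I : finType) X Y Z (g : Hom Y Z) (F : I -> Hom X Y) :
  g \*c (\sum_i F i) = \sum_i (g \*c F i).
Proof. exact: (big_morph (compm g) (compmDr g) (compm0 X g)). Qed.

Lemma is_zero_domP X Y (f : Hom X Y) : is_zero X -> f = 0.
Proof. by move=> X0; rewrite -(comp_idr f) X0 compm0. Qed.

Lemma is_zero_codP X Y (f : Hom X Y) : is_zero Y -> f = 0.
Proof. by move=> Y0; rewrite -(comp_idl f) Y0 comp0m. Qed.

Lemma is_iso_id X : is_iso (idm X).
Proof. by exists (idm X); rewrite comp_idl. Qed.

Lemma isomorphic_refl X : isomorphic X X.
Proof. by exists (idm X); apply: is_iso_id. Qed.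

Lemma isomorphic_sym X Y : isomorphic X Y -> isomorphic Y X.
Proof. by move=> [f [g [gf fg]]]; exists g, f. Qed.

Lemma is_iso_comp X Y Z (g : Hom Y Z) (f : Hom X Y) :
  is_iso g -> is_iso f -> is_iso (g \*c f).
Proof.
move=> [g' [g'g gg']] [f' [f'f ff']]; exists (f' \*c g'); split.
  by rewrite comp_assoc -(comp_assoc f') g'g comp_idr.
by rewrite comp_assoc -(comp_assoc g) ff' comp_idr.
Qed.

Lemma isomorphic_trans Y X Z : isomorphic X Y -> isomorphic Y Z -> isomorphic X Z.
Proof. by move=> [f fi] [g gi]; exists (g \*c f); apply: is_iso_comp. Qed.

Lemma iso_comp_eq0 X Y Z (g : Hom Y Z) (f : Hom X Y) :
  is_iso g -> g \*c f = 0 -> f = 0.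
Proof.
by move=> [g' [g'g _]] gf; rewrite -(comp_idl f) -g'g -comp_assoc gf compm0.
Qed.

Lemma comp_iso_eq0 X Y Z (g : Hom Y Z) (f : Hom X Y) :
  is_iso f -> g \*c f = 0 -> g = 0.
Proof.
by move=> [f' [_ ff']] gf; rewrite -(comp_idr g) -ff' comp_assoc gf comp0m.
Qed.

Lemma dsum_of_iso X Y : isomorphic X Y -> dsum_of (fun _ : 'I_1 => Y) X.
Proof.
move=> [f [g [gf fg]]]; exists (fun=> g), (fun=> f); split=> //.
  by move=> k l; rewrite (ord1 k) (ord1 l).
by rewrite big_ord1.
Qed.

Lemma add_closed_iso (T : set C) X Y :
  add_closed T -> isomorphic X Y -> T Y -> T X.
Proof. by move=> [h _] /dsum_of_iso/h hX TY; apply: hX. Qed.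

Lemma is_summand_comp X Y (i : Hom Y X) (p : Hom X Y) Y' (i' : Hom Y' X)
    (p' : Hom X Y') :
  p \*c i = idm Y -> p' \*c i' = idm Y' -> p \*c i' = 0 -> p' \*c i = 0 ->
  i \*c p + i' \*c p' = idm X -> is_summand Y X.
Proof.
move=> pi p'i' pi' p'i s1; exists Y'.
exists (fun b => match b return Hom (pair_of Y Y' b) X with
          true => i | false => i' end).
exists (fun b => match b return Hom X (pair_of Y Y' b) with
          true => p | false => p' end).
by split; [case|case=> -[]|rewrite big_bool].
Qed.

Lemma dsum_bool_summand (Y : bool -> C) X b :
  dsum_of Y X -> is_summand (Y b) X.
Proof.
move=> [i [p [pi pi0 s1]]]; apply: (is_summand_comp (pi b) (pi (~~ b))).
- by apply: pi0; case: b.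
- by apply: pi0; case: b.
- by rewrite -s1 big_bool; case: b; rewrite //= addrC.
Qed.

Hypothesis dsums : has_finite_dsums C.

Lemma ex_zero : exists Z, is_zero Z.
Proof.
have [Z [i [p [_ _ s]]]] := dsums (fun k : 'I_0 => False_rect C (notF (ltn_ord k))).
by exists Z; rewrite /is_zero -s big_ord0.
Qed.

(** The complement is a direct sum [W] of the remaining terms; its inclusion and projection are
    assembled from those of [X] and of [W]. *)
Lemma dsum_ord_summand m (Y : 'I_m -> C) X k :
  dsum_of Y X -> is_summand (Y k) X.
Proof.
case: m Y k => [Y []//|m Y k] [i [p [pi pi0 s1]]].
have [W [j [q [qj qj0 t1]]]] := dsums (fun l => Y (lift k l)).
have pl (l : 'I_m) : k <> lift k l by move/eqP; rewrite (negPf (neq_lift _ _)).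
pose i' := \sum_l (i (lift k l) \*c q l).
pose p' := \sum_l (j l \*c p (lift k l)).
have pi' l : p (lift k l) \*c i' = q l.
  rewrite comp_sumr (bigD1 l) //= comp_assoc pi comp_idl big1 ?addr0 // => h hl.
  by rewrite comp_assoc pi0 ?comp0m // => /lift_inj/esym/eqP; apply/negP.
apply: (is_summand_comp (i := i k) (p := p k) (i' := i') (p' := p')) => //.
- rewrite comp_suml -t1; apply: eq_bigr => l _.
  by rewrite -comp_assoc pi'.
- rewrite comp_sumr big1 // => l _.
  by rewrite comp_assoc pi0 ?comp0m.
- rewrite comp_suml big1 // => l _.
  by rewrite -comp_assoc pi0 ?compm0 //; apply: nesym.
- rewrite -s1 (bigD1_ord k) //=; congr (_ + _).
  rewrite comp_sumr; apply: eq_bigr => l _.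
  rewrite comp_assoc comp_suml (bigD1 l) //= -comp_assoc qj comp_idr.
  rewrite big1 ?addr0 // => h hl.
  by rewrite -comp_assoc qj0 ?compm0 //; apply/eqP.
Qed.

(** The two idempotents of a decomposition add up to the identity, so one of them is invertible;
    since the opposite projection kills it, that projection vanishes. *)
Lemma local_end_indec X : local_end X -> indecomposable X.
Proof.
move=> [X0 loc]; split=> // Y Z [i [p [pi pi0 s1]]].
have aux b : is_iso (i b \*c p b) -> is_zero (pair_of Y Z (~~ b)).
  move=> e; have : p (~~ b) \*c (i b \*c p b) = 0.
    by rewrite comp_assoc pi0 ?comp0m //; case: b e.
  by move/(comp_iso_eq0 e) => p0; rewrite /is_zero -pi p0 comp0m.
have := loc (i true \*c p true) (i false \*c p false).
case; last by move/aux; left.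
  by move: s1; rewrite big_bool => ->; exists (idm X); rewrite comp_idl.
by move/aux; right.
Qed.

(** Under the Krull-Schmidt property, subcategories closed under sums and summands are compared on
    indecomposable objects alone. *)
Lemma krull_schmidt_sub (T U : set C) :
  krull_schmidt C -> add_closed T -> add_closed U ->
  (forall X, indecomposable X -> T X -> U X) -> T `<=` U.
Proof.
move=> ks [_ Tsum] [Udsum _] H X TX.
have [m [Y [loc dX]]] := ks X; apply: (Udsum _ _ _ dX) => k.
have sk := dsum_ord_summand k dX.
by apply: H; [apply: local_end_indec|apply: (Tsum _ _ sk)].
Qed.

Lemma add_hull_closed (A : set C) : add_closed (add_hull A).
Proof.
split=> [m Y X dX hY T Tc AT|X Y sX hY T Tc AT].
  by case: (Tc) => h _; apply: h dX _ => k; apply: hY.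
by case: (Tc) => _ h; apply: h sX _; apply: hY.
Qed.

End LinearCategoryTheory.

(** * Weak cokernels and closure properties of thick subcategories *)

Section TriangulatedTheory.
Variables (K : fieldType) (C : triangulated_category K).
Implicit Types X Y Z W : C.

Let S0 X Y : susp_mor (0 : Hom X Y) = 0. Proof. exact: raddf0. Qed.

Lemma susp_mor_id X : susp_mor (idm X) = idm (susp X).
Proof. exact: (susp_functor C).1. Qed.

Lemma susp_mor_comp X Y Z (g : Hom Y Z) (f : Hom X Y) :
  susp_mor (g \*c f) = susp_mor g \*c susp_mor f.
Proof. exact: (susp_functor C).2. Qed.

Lemma susp_mor_inj X Y : injective (@susp_mor _ C X Y).
Proof. exact: bij_inj (susp_ff X Y). Qed.

Lemma susp_mor_full X Y (f : Hom (susp X) (susp Y)) :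
  exists g : Hom X Y, f = susp_mor g.
Proof. by have [h hK Kh] := susp_ff X Y; exists (h f); rewrite Kh. Qed.

Lemma susp_mor_eq0 X Y (f : Hom X Y) : susp_mor f = 0 -> f = 0.
Proof. by move=> f0; apply: susp_mor_inj; rewrite f0 S0. Qed.

Lemma is_zero_susp X : is_zero X -> is_zero (susp X).
Proof. by move=> X0; rewrite /is_zero -susp_mor_id X0 S0. Qed.

Lemma isomorphic_susp X Y : isomorphic X Y -> isomorphic (susp X) (susp Y).
Proof.
move=> [f [g [gf fg]]]; exists (susp_mor f), (susp_mor g).
by rewrite -!susp_mor_comp gf fg !susp_mor_id.
Qed.

Lemma isomorphic_susp_inj X Y : isomorphic (susp X) (susp Y) -> isomorphic X Y.
Proof.
move=> [f' [g' [gf fg]]]; have [f ef] := susp_mor_full f'.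
have [g eg] := susp_mor_full g'; subst f' g'; exists f, g.
by split; apply: susp_mor_inj; rewrite susp_mor_comp susp_mor_id.
Qed.

Lemma desusp_susp X : isomorphic (desusp (susp X)) X.
Proof. exact/isomorphic_susp_inj/susp_desusp. Qed.

(** The rotated triangle is mapped to the trivial triangle on the identity of [W]; the third
    component of this morphism is the factor. *)
Lemma triangle_weak_cokernel X Y Z W (u : Hom X Y) (v : Hom Y Z)
    (w : Hom Z (susp X)) (f : Hom Z W) :
  triangle u v w -> f \*c v = 0 -> exists g : Hom (susp X) W, f = g \*c w.
Proof.
move=> /triangle_rotate tr fv; have [V V0] := ex_zero (tcat_dsums (t := C)).
have : triangle (0 : Hom V W) (idm W) (0 : Hom W (susp V)).
  by apply/triangle_rotate; rewrite S0 oppr0; apply/triangle_id/is_zero_susp.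
move/(triangle_morphism tr (a := 0) (b := f)); case=> [|c [cw _]].
  by rewrite fv comp0m.
by exists c; rewrite cw comp_idl.
Qed.

Variable T : set C.
Hypothesis Tthick : is_thick T.

Lemma thick_add_closed : add_closed T. Proof. by case: Tthick. Qed.

Lemma thick_iso X Y : isomorphic X Y -> T Y -> T X.
Proof. by move=> XY; apply: add_closed_iso XY; apply: thick_add_closed. Qed.

Lemma thick_susp X : T (susp X) <-> T X.
Proof.
case: Tthick => _ _ Ts Td; split=> [/Td|/Ts//].
exact/thick_iso/isomorphic_sym/desusp_susp.
Qed.

(** Rotating twice exhibits [susp Y] as the cone of a map from [Z] to [susp X]. *)
Lemma thick_middle X Y Z (u : Hom X Y) (v : Hom Y Z) (w : Hom Z (susp X)) :
  triangle u v w -> T X -> T Z -> T Y.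
Proof.
move=> /triangle_rotate/triangle_rotate tr /thick_susp TX TZ.
by case: Tthick => _ Tc _ _; apply/thick_susp; apply: Tc tr TZ TX.
Qed.

End TriangulatedTheory.

(* The maps from an object of [ind_orth] to an object of [S] need not vanish, but
   only to die along maps out of [S] that preserve the class [M] of nonzero
   maps: this emulates orthogonality to a filtered colimit of objects of [S]
   that does not exist in [C]. *)
Section IndOrthogonal.
Variables (K : fieldType) (C : triangulated_category K) (S : set C).
Variable M : forall X Y : C, Hom X Y -> Prop.
Implicit Types X Y Z : C.

Definition preserving Y Z (g : Hom Y Z) : Prop :=
  forall X (h : Hom X Y), M h -> M (g \*c h).

Definition ind_orth : set C :=
  [set X | forall Y (f : Hom X Y), S Y ->
     exists Z (g : Hom Y Z), [/\ S Z, preserving g & g \*c f = 0]].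

Lemma preserving_comp X Y Z (g : Hom Y Z) (f : Hom X Y) :
  preserving g -> preserving f -> preserving (g \*c f).
Proof. by move=> pg pf W h Mh; rewrite -comp_assoc; apply/pg/pf. Qed.

Lemma preserving_id X : preserving (idm X).
Proof. by move=> Y h; rewrite comp_idl. Qed.

Lemma ind_orth_add_closed : add_closed ind_orth.
Proof.
split=> [m Y X [i [p [_ _ s1]]] oY|X Y [X' [i [p [pi _ _]]]] oY W f SW].
  move=> W f SW.
  (* A single map must kill every component of [f]: the components are treated one after the other,
     composing the preserving maps. *)
  have [Z [g [SZ pg gf]]] : exists Z (g : Hom W Z), [/\ S Z, preserving g &
      forall k, k \in enum 'I_m -> g \*c (f \*c i k) = 0].
    elim: (enum _) => [|k s [Z [g [SZ pg gf]]]].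
      by exists W, (idm W); split=> //; apply: preserving_id.
    have [Z' [g' [SZ' pg' gf']]] := oY k _ (g \*c (f \*c i k)) SZ.
    exists Z', (g' \*c g); split=> [//||l]; first exact: preserving_comp.
    by rewrite inE -comp_assoc => /predU1P[->//|/gf ->]; rewrite compm0.
  exists Z, g; split=> //; rewrite -(comp_idr f) -s1 !comp_sumr big1 // => k _.
  by rewrite !comp_assoc -(comp_assoc g) gf ?comp0m // mem_enum.
have [Z [g [SZ pg gf]]] := oY _ (f \*c p true) SW.
by exists Z, g; split=> //; rewrite -(comp_idr f) -(pi true) !comp_assoc
  -(comp_assoc g) gf comp0m.
Qed.

Hypothesis S_susp : forall X, S X -> S (susp X).
Hypothesis S_desusp : forall X, S X -> exists2 Y, S Y & isomorphic X (susp Y).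
Hypothesis M_neq0 : forall X Y (h : Hom X Y), M h -> h <> 0.
Hypothesis M_iso : forall X Y X' Y' (t : Hom X' X) (h : Hom X Y) (s : Hom Y Y'),
  is_iso t -> is_iso s -> M h -> M (s \*c h \*c t).
Hypothesis M_susp : forall X Y (h : Hom X Y), M (susp_mor h) <-> M h.

Lemma ind_orthPn X Y (f : Hom X Y) : M f -> S Y -> ~ ind_orth X.
Proof.
move=> Mf SY /(_ _ f SY)[Z [g [_ pg gf]]].
exact: M_neq0 (pg _ _ Mf) gf.
Qed.

(** Up to isomorphism, a map from [susp X] to an object of [S] is the suspension of a map from [X];
    the suspension of a map killing the latter kills the former. *)
Lemma ind_orth_susp X : ind_orth X -> ind_orth (susp X).
Proof.
move=> oX Y f SY; have [V SV [s si]] := S_desusp SY.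
have [k ek] := susp_mor_full (s \*c f); have [Z [g [SZ pg gk]]] := oX _ k SV.
exists (susp Z), (susp_mor g \*c s); split; first exact: S_susp.
  move=> B h Mh; have [t [t' [t't tt']]] := susp_desusp B.
  have [h' eh'] := susp_mor_full (s \*c h \*c t).
  have /M_susp/pg/M_susp : M (susp_mor h').
    by rewrite -eh'; apply: M_iso => //; exists t'.
  have t'i : is_iso t' by exists t.
  move/(M_iso t'i (is_iso_id _)); rewrite comp_idl susp_mor_comp -eh'.
  by rewrite -!comp_assoc tt' comp_idr.
by rewrite -comp_assoc ek -susp_mor_comp gk raddf0.
Qed.

Lemma ind_orth_desusp X : ind_orth X -> ind_orth (desusp X).
Proof.
move=> oX Y f SY; have [r [r' [r'r rr']]] := susp_desusp X.
have [Z [g [SZ pg gf]]] := oX _ (susp_mor f \*c r') (S_susp SY).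
have [V SV [s si]] := S_desusp SZ.
have [h eh] := susp_mor_full (s \*c g).
exists V, h; split=> // [B b Mb|].
  apply/M_susp; rewrite susp_mor_comp -eh -comp_assoc -[X in M X]comp_idr.
  by apply: M_iso => //; [apply: is_iso_id|apply/pg/M_susp].
apply: susp_mor_eq0; rewrite susp_mor_comp -eh.
by rewrite -(comp_idr (susp_mor f)) -r'r !comp_assoc -!comp_assoc
  (comp_assoc g) (comp_assoc (_ \*c _)) -(comp_assoc g) gf comp0m compm0.
Qed.

(** For cones, [f] is killed in two stages: a first map kills its restriction to [Y], so that what
    remains factors through [susp X], where a second map kills it. *)
Lemma ind_orth_thick : is_thick ind_orth.
Proof.
split; [exact: ind_orth_add_closed| |exact: ind_orth_susp|exact: ind_orth_desusp].
move=> X Y Z u v w tr /ind_orth_susp oX oY W f SW.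
have [W1 [g [SW1 pg gfv]]] := oY _ (f \*c v) SW.
rewrite comp_assoc in gfv.
have [f' ef] := triangle_weak_cokernel tr gfv.
have [W2 [h [SW2 ph hf]]] := oX _ f' SW1.
exists W2, (h \*c g); split=> //; first exact: preserving_comp.
by rewrite -comp_assoc ef comp_assoc hf comp0m.
Qed.

End IndOrthogonal.

(** * Coordinates on an admissible set *)

Section Enumeration.
Variable R : realType.
Implicit Types (E : set R) (S T c m : R).

(** The successor of a point is the infimum of the larger points, attained because nothing
    accumulates there. A point missed by iterating it would bound all iterates, and their supremum
    would be an accumulation point. *)
Lemma enumerate_above E c T :
  E c -> (forall x, E x -> x < T) ->
  (forall x, E x -> exists2 y, E y & x < y) ->
  (forall m, c <= m < T ->
     exists2 e, 0 < e & forall x, E x -> `|x - m| < e -> x = m) ->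
  exists f : nat -> R,
    [/\ f 0%N = c, forall k, E (f k), {homo f : k l / (k < l)%N >-> k < l} &
        forall x, E x -> c <= x -> exists k, x = f k].
Proof.
move=> Ec ET Emax Eacc.
have [s sP] : {s : R -> R & forall x, E x /\ c <= x ->
    [/\ E (s x), x < s x & forall y, E y -> x < y -> s x <= y]}.
  apply: (@choice _ _ (fun x y => E x /\ c <= x ->
    [/\ E y, x < y & forall z, E z -> x < z -> y <= z])) => x.
  have [[Ex cx]|] := pselect (E x /\ c <= x); last by exists 0.
  have [y Ey xy] := Emax _ Ex.
  pose F := [set z | E z /\ x < z].
  have Finf : has_inf F by split; [exists y|exists x => z [_ /ltW]].
  have lxF : x <= inf F by apply: lb_le_inf; [exists y|move=> z [_ /ltW]].
  have lFy z : E z -> x < z -> inf F <= z.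
    by move=> Ez xz; apply: ge_inf => //; case: Finf.
  have [|e e0 He] := Eacc (inf F).
    by rewrite (le_trans cx lxF) (le_lt_trans (lFy _ Ey xy) (ET _ Ey)).
  have [z [Ez xz] zF] := inf_adherent e0 Finf.
  have ez : z = inf F.
    apply: He => //; have := lFy _ Ez xz => Fz.
    by rewrite ger0_norm ?subr_ge0 // ltrBlDl.
  by exists z => _; split=> // w Ew xw; rewrite ez; apply: lFy.
have fP k : E (iter k s c) /\ c <= iter k s c.
  elim: k => [|k IHk] //=; have [h1 h2 _] := sP _ IHk.
  by split=> //; apply: le_trans (ltW h2); case: IHk.
have fS k : iter k s c < iter k.+1 s c by have [] := sP _ (fP k).
exists (fun k => iter k s c); split=> //.
- by move=> k; have [] := fP k.
- exact: (homo_ltn lt_trans).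
move=> x Ex cx; apply/not_existsP => nx.
have lex k : iter k s c < x.
  elim: k => [|k IHk]; rewrite lt_neqAle; apply/andP; split=> //.
  - by apply/eqP => /esym/(nx 0%N).
  - by apply/eqP => /esym/(nx k.+1).
  by have [_ _] := sP _ (fP k); apply.
pose F := range (fun k => iter k s c).
have Fsup : has_sup F.
  by split; [exists c, 0%N|exists x => _ [k _ <-]; apply: ltW].
have leF k : iter k s c <= sup F.
  by apply: ub_le_sup; [case: Fsup|exists k].
have [|e e0 He] := Eacc (sup F).
  rewrite (leF 0%N) /=; apply: le_lt_trans (ET _ Ex).
  by apply: ge_sup; [case: Fsup|move=> _ [k _ <-]; apply: ltW].
have [_ [k _ <-] kF] := sup_adherent e0 Fsup.
have ek : iter k s c = sup F.
  apply: He; first by case: (fP k).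
  by rewrite distrC ger0_norm ?subr_ge0 ?leF // ltrBlDl -ltrBlDr.
by have := leF k.+1; rewrite leNgt -ek fS.
Qed.

Lemma enumerate_int E S T :
  E !=set0 -> (forall x, E x -> S < x < T) ->
  (forall x, E x -> exists2 y, E y & x < y) ->
  (forall x, E x -> exists2 y, E y & y < x) ->
  (forall m, S < m < T ->
     exists2 e, 0 < e & forall x, E x -> `|x - m| < e -> x = m) ->
  exists f : int -> R,
    {homo f : k l / k < l} /\ forall x, E x <-> exists k, x = f k.
Proof.
move=> [c Ec] EST Emax Emin Eacc; have /andP[Sc cT] := EST c Ec.
have [||m|f [f0 fE fmono fsurj]] := @enumerate_above E c T Ec.
- by move=> x /EST/andP[].
- exact: Emax.
- by move=> /andP[cm mT]; apply: Eacc; rewrite (lt_le_trans Sc cm).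
have [||||g [g0 gE gmono gsurj]] := @enumerate_above (-%R @^-1` E) (- c) (- S).
- by rewrite /= opprK.
- by move=> x /= /EST/andP[+ _]; rewrite ltrNr.
- by move=> x /= /Emin[y Ey yx]; exists (- y); rewrite /= ?opprK // ltrNr.
- move=> m /andP[cm mS]; have [|e e0 He] := Eacc (- m).
    by rewrite ltrNr mS /=; apply: le_lt_trans cT; rewrite lerNl.
  exists e => // x Ex xm; apply: oppr_inj; apply: He => //.
  by rewrite -opprD normrN.
(* [Negz k] stands for [- k.+1], so the descending enumeration is entered at [k.+1]; its term [0] is
   [- c], already reached by [f]. *)
exists (fun k => match k with Posz k => f k | Negz k => - g k.+1 end); split.
  have fc k : c <= f k by case: k => [|k]; rewrite -f0 // ltW // fmono.
  have gc k : - g k.+1 < c by rewrite ltrNl -g0 gmono.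
  case=> k [l|l] kl.
  - by apply: fmono; lia.
  - lia.
  - exact: lt_le_trans (fc l).
  - by rewrite ltrN2; apply: gmono; lia.
move=> x; split=> [Ex|[[k|k] ->] //]; last exact: gE.
have [cx|xc] := leP c x; first by have [k ->] := fsurj _ Ex cx; exists (Posz k).
have [||[|k] ek] := gsurj (- x); rewrite /= ?opprK ?lerN2 // ?ltW //.
  by move: xc; rewrite -(opprK x) ek g0 opprK ltxx.
by exists (Negz k); rewrite -ek opprK.
Qed.

End Enumeration.

(** * Angles of points of the circle and their cyclic order *)

Section Angle.
Variable R : realType.
Implicit Types t u v : R.
Local Notation pt := (@circle_pt R).

Lemma circle_pt_circle t : circle (pt t).
Proof. by rewrite /circle /= cos2Dsin2. Qed.

(** The sine of half the difference vanishes, and this half lies strictly between [- pi] and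
    [pi]. *)
Lemma circle_pt_inj t u : `|t - u| < 2 * pi -> pt t = pt u -> t = u.
Proof.
move=> tu [ec es]; apply/eqP; rewrite -subr_eq0; apply/eqP.
set x := (t - u) / 2.
have xE : t - u = x *+ 2 by rewrite /x; field.
have cx : cos (x *+ 2) = 1 by rewrite -xE cosB -ec -es -!expr2 cos2Dsin2.
have sx : sin x = 0.
  move: cx; rewrite cos_mulr2n => cx; have := cos2Dsin2 x => sx.
  by apply/eqP; rewrite -sqrf_eq0; apply/eqP; lra.
suff x0 : x = 0 by rewrite xE x0 mul0rn.
apply/eqP/negPn/negP => x0.
have xpi : `|x| < pi by rewrite /x normrM (ger0_norm (x := 2^-1)) // ltr_pdivrMr // mulrC.
have : 0 < sin `|x| by apply: sin_gt0_pi; rewrite normr_gt0 x0.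
by case: (ger0P x) => _; rewrite ?sinN sx ?oppr0 ltxx.
Qed.

Lemma circle_ptD2pi t (k : nat) : pt (t + 2 * pi * k%:R) = pt t.
Proof.
have -> : 2 * pi * k%:R = (pi *+ 2) *+ k :> R by rewrite mulr_natr mulr_natl.
by rewrite /circle_pt (periodicn (@cosD2pi R)) (periodicn (@sinD2pi R)).
Qed.

Lemma circle_ptDz2pi t (k : int) : pt (t + 2 * pi * k%:~R) = pt t.
Proof.
case: k => k; first exact: circle_ptD2pi.
rewrite -(circle_ptD2pi _ k.+1) NegzE; congr circle_pt.
by rewrite mulrNz -pmulrn; ring.
Qed.

Lemma shift2pi t (s : R) : exists k : int, s <= t + 2 * pi * k%:~R < s + 2 * pi.
Proof.
have p0 : 0 < 2 * pi :> R by rewrite mulr_gt0 // pi_gt0.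
set k := Num.floor ((t - s) / (2 * pi)).
have := Num.Theory.floor_itv ((t - s) / (2 * pi)).
rewrite -/k ler_pdivlMr // ltr_pdivrMr // rmorphD /= => /andP[h1 h2].
exists (- k); rewrite mulrNz.
by move: h1 h2; set q := k%:~R => h1 h2; apply/andP; split; lra.
Qed.

Lemma circle_pt_eq t u : pt t = pt u -> exists k : int, u = t + 2 * pi * k%:~R.
Proof.
move=> tu; have [k /andP[tk kt]] := shift2pi u t.
exists (- k); rewrite mulrNz.
have : t = u + 2 * pi * k%:~R; last by move=> {1}->; ring.
by apply: circle_pt_inj; rewrite ?circle_ptDz2pi // ltr_norml; lra.
Qed.

Lemma circle_ptP (x : R * R) (s : R) :
  circle x -> exists2 t, s <= t < s + 2 * pi & x = pt t.
Proof.
move=> cx.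
have [t xt] : exists t, x = pt t.
  have x1 : -1 <= x.1 <= 1.
    have : x.1 ^+ 2 <= 1 by rewrite -cx lerDl sqr_ge0.
    by move=> x1; apply/andP; split; nra.
  have y2 : sin (acos x.1) ^+ 2 = x.2 ^+ 2.
    have := cos2Dsin2 (acos x.1); rewrite acosK // => h.
    by apply: (addrI (x.1 ^+ 2)); rewrite h cx.
  move/eqP: y2; rewrite eqf_sqr => /orP[]/eqP y2.
    by exists (acos x.1); rewrite /circle_pt acosK // y2; case: x {cx x1 y2}.
  exists (- acos x.1); rewrite /circle_pt cosN sinN acosK // y2 opprK.
  by case: x {cx x1 y2}.
have [k tk] := shift2pi t s.
by exists (t + 2 * pi * k%:~R); rewrite ?circle_ptDz2pi.
Qed.

Lemma cycP (s : R) t u v :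
  s <= t < s + 2 * pi -> s <= u < s + 2 * pi -> s <= v < s + 2 * pi ->
  cyc (pt t) (pt u) (pt v) <-> [\/ t < u < v, u < v < t | v < t < u].
Proof.
have p0 : 0 < pi :> R := pi_gt0 R.
move=> /andP[st ts] /andP[su us] /andP[sv vs].
split=> [[t' [u' [v' [[tu uv vt] [et eu ev]]]]]|].
  have [k ek] := circle_pt_eq et.
  (* Subtracting the multiple of the full turn that takes [t'] to [t] leaves each of [u'], [v']
     equal to the angle in the turn starting at [s] or one turn above it. *)
  have lift w w' : s <= w -> w < s + 2 * pi -> t' < w' -> w' < t' + 2 * pi ->
      pt w = pt w' -> w' - 2 * pi * k%:~R \in [:: w; w + 2 * pi].
    move=> sw ws tw wt ew; rewrite !inE.
    have [ws'|ws'] := ltP (w' - 2 * pi * k%:~R) (s + 2 * pi).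
      apply/orP; left; apply/eqP/esym/circle_pt_inj; first by rewrite ltr_norml; lra.
      by rewrite ew -(circle_ptDz2pi w' (- k)) mulrNz mulrN.
    apply/orP; right; rewrite -subr_eq; apply/eqP/esym/circle_pt_inj.
      by rewrite ltr_norml; lra.
    rewrite ew -(circle_ptDz2pi w' (- k - 1)); congr circle_pt.
    by rewrite rmorphB /= mulrNz; ring.
  have := lift _ _ su us tu (lt_trans uv vt) eu.
  have := lift _ _ sv vs (lt_trans tu uv) vt ev.
  move: (2 * pi * k%:~R) ek => q ek; rewrite !inE.
  case/orP=> /eqP ev' /orP[]/eqP eu'.
  - by apply: Or31; apply/andP; split; lra.
  - by exfalso; lra.
  - by apply: Or33; apply/andP; split; lra.
  - by apply: Or32; apply/andP; split; lra.
case=> /andP[h1 h2].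
- by exists t, u, v; split; split=> //; lra.
- exists t, (u + 2 * pi * 1%:R), (v + 2 * pi * 1%:R).
  by rewrite !circle_ptD2pi; split; split=> //; lra.
- exists t, u, (v + 2 * pi * 1%:R).
  by rewrite !circle_ptD2pi; split; split=> //; lra.
Qed.

End Angle.

(** * Construction of the coordinates *)

Section Coordinates.
Variables (R : realType) (Z : set (R * R)) (n : nat) (a : 'I_n.+1 -> R * R).
Hypothesis hZ : admissible Z a.
Local Notation pt := (@circle_pt R).

(** Two-sidedness provides a relation [cyc] ending at [a i], and such a relation comes with an angle
    for each of its points. *)
Lemma limit_point_circle i : circle (a i).
Proof.
have pi0 := pi_gt0 R.
have [x cx xa] : exists2 x, circle x & x <> a i.
  have [e|] := pselect (a i = pt 0); last first.
    by move=> h; exists (pt 0); [exact: circle_pt_circle|move=> /esym].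
  exists (pt pi); first exact: circle_pt_circle.
  rewrite e => h; have := circle_pt_inj _ h; rewrite subr0 gtr0_norm //.
  by move=> pi00; have : pi = 0 :> R; [apply: pi00; lra|lra].
have [[z _ [t [u [v [_ [_ _ ->]]]]]] _] := adm_two_sided hZ cx xa.
exact: circle_pt_circle.
Qed.

(** Angles are taken in the turn starting at the first limit point. Indexing by [nat] lets [t n.+1]
    stand for that point reached again after a full turn, so that no interval of angles wraps
    around. *)
Lemma limit_angles : exists t : nat -> R,
  [/\ forall i : 'I_n.+1, a i = pt (t i) /\ a (ordS i) = pt (t i.+1),
      forall k l, (k < l <= n.+1)%N -> t k < t l & t n.+1 = t 0%N + 2 * pi].
Proof.
have pi0 := pi_gt0 R.
have [s _ es] := circle_ptP 0 (limit_point_circle ord0).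
have [t tP] : {t : 'I_n.+1 -> R & forall i, s <= t i < s + 2 * pi /\ a i = pt (t i)}.
  apply: (@choice _ _ (fun i y => s <= y < s + 2 * pi /\ a i = pt y)) => i.
  by have [y ys ey] := circle_ptP s (limit_point_circle i); exists y.
have t0 : t ord0 = s.
  have [/andP[h1 h2] h] := tP ord0.
  by apply: circle_pt_inj; rewrite -?h // ltr_norml; lra.
have tpos (i : 'I_n.+1) : (0 < i)%N -> s < t i.
  have [/andP[h1 h2] h] := tP i => i0; rewrite lt_neqAle h1 andbT.
  apply/eqP => e; have : a i = a ord0 by rewrite h es -e.
  by move/(adm_inj hZ) => ei; rewrite ei in i0.
have tmono (i j : 'I_n.+1) : (i < j)%N -> t i < t j.
  move=> ij; have [i0|i0] := posnP i.
    have -> : i = ord0 by apply: val_inj.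
    by rewrite t0 tpos //; lia.
  have := @adm_cyclic _ _ _ _ hZ ord0 i j i0 ij; have := tpos _ i0.
  have [h1 ->] := tP i; have [h2 ->] := tP j; rewrite es => si /cycP.
  have : s <= s < s + 2 * pi by apply/andP; split; lra.
  move=> h3 /(_ s h3 h1 h2); case=> /andP[]; lra.
exists (fun k => if (k < n.+1)%N then t (inord k) else s + 2 * pi).
have tS (i : 'I_n.+1) : t (inord i) = t i by rewrite inord_val.
split.
- move=> i; rewrite ltn_ord tS; split; first by have [] := tP i.
  case: ltnP => [i1|i1].
    have [_ ->] := tP (ordS i); congr (pt (t _)).
    by apply: val_inj; rewrite /= inordK // modn_small.
  have -> : ordS i = ord0.
    apply: val_inj => /=; have -> : i.+1 = n.+1 by have := ltn_ord i; lia.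
    by rewrite modnn.
  by rewrite -(circle_ptD2pi s 1) mulr1 in es.
- move=> k l /andP[kl ln].
  have -> : (k < n.+1)%N by lia.
  case: ltnP => ln'; first by apply: tmono; rewrite !inordK //; lia.
  by have [/andP[]] := tP (inord k).
- rewrite ltnn /=; congr (_ + _); rewrite -t0; congr t; apply: val_inj.
  by rewrite /= inordK.
Qed.

Lemma circle_pt_continuous : continuous pt.
Proof.
by move=> x; apply: (cvg_pair (continuous_cos (x := x)) (continuous_sin (x := x))).
Qed.

Definition pos m := ('I_m * int)%type.

Definition ltpos m (p q : pos m) : bool :=
  (p.1 < q.1)%N || (val p.1 == val q.1) && (p.2 < q.2).

Definition cycpos m (p q r : pos m) : bool :=
  [|| ltpos p q && ltpos q r, ltpos q r && ltpos r p | ltpos r p && ltpos p q].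

(** In each interval of angles, two-sidedness leaves no extreme point of [Z], and all accumulation
    happens at limit points, so [enumerate_int] numbers the points by the integers. *)
Lemma admissible_coord : exists e : pos n.+1 -> R * R,
  [/\ injective e,
      forall z, Z z <-> exists p, z = e p,
      forall i z, interval_of Z a i z <-> exists k, z = e (i, k) &
      forall p q r, cyc (e p) (e q) (e r) <-> cycpos p q r].
Proof.
have pi0 := pi_gt0 R.
have [t [ta tmono tn]] := limit_angles.
have tS (i : 'I_n.+1) : t i < t i.+1 by apply: tmono; rewrite leqnn ltn_ord.
have t0i (i : 'I_n.+1) : t 0%N <= t i.
  have [->//|i0] := posnP i.
  by apply/ltW/tmono; rewrite i0 /= ltnW.
have ttn (i : 'I_n.+1) : t i.+1 <= t 0%N + 2 * pi.
  rewrite -tn; have [->//|i0] : i.+1 = n.+1 \/ (i.+1 < n.+1)%N.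
    by have := ltn_ord i; lia.
  by apply/ltW/tmono; rewrite i0 /=.
have tnear (i : 'I_n.+1) x y : t i <= x < t i.+1 -> t i <= y < t i.+1 ->
    pt x = pt y -> x = y.
  move=> /andP[h1 h2] /andP[h3 h4]; apply: circle_pt_inj.
  by rewrite ltr_norml; have := t0i i; have := ttn i; lra.
have notZ i : ~ Z (a i).
  have : range a (a i) by exists i.
  by rewrite (adm_limit_points hZ) => -[].
have nota (i : 'I_n.+1) x : t i < x < t i.+1 -> ~ range a (pt x).
  move=> /andP[h1 h2] [k _ ek].
  have := t0i k; have := ttn k; have := t0i i; have := ttn i; have := tS k.
  move=> g1 g2 g3 g4 g5.
  have ekx : t k = x.
    have [+ _] := ta k; rewrite ek => exk; apply: circle_pt_inj => //.
    by rewrite ltr_norml; lra.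
  have [ik|ki|ik] := ltngtP i k.
  - suff : t i.+1 <= t k by lra.
    have [->//|ik1] : i.+1 = k \/ (i.+1 < k)%N by lia.
    by apply/ltW/tmono; rewrite ik1 /= ltnW.
  - have : t k < t i; last by lra.
    by apply: tmono; rewrite ki /= ltnW.
  - by move: ekx; rewrite -ik; lra.
pose E (i : 'I_n.+1) := [set x | t i < x < t i.+1 /\ Z (pt x)].
have Emax (i : 'I_n.+1) x : t i < x < t i.+1 -> exists2 y, E i y & x < y.
  move=> /andP[h1 h2]; have := t0i i; have := ttn i => h3 h4.
  have [|[z Zz cz] _] := adm_two_sided hZ (i := ordS i) (circle_pt_circle x).
    have [_ ->] := ta i => /circle_pt_inj e; have : x = t i.+1; last by lra.
    by apply: e; rewrite ltr_norml; lra.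
  have [y yx ez] := circle_ptP x (adm_circle hZ Zz); move: cz; rewrite ez.
  have [_ ->] := ta i; move=> /(@cycP _ x); case.
  - by apply/andP; split; lra.
  - by [].
  - by apply/andP; split; lra.
  - move=> /andP[xy yt]; exists y => //; split; last by rewrite -ez.
    by rewrite yt andbT; lra.
  - by move=> /andP[]; lra.
  - by move=> /andP[]; lra.
have Emin (i : 'I_n.+1) x : t i < x < t i.+1 -> exists2 y, E i y & y < x.
  move=> /andP[h1 h2]; have := t0i i; have := ttn i => h3 h4.
  have [|_ [z Zz cz]] := adm_two_sided hZ (i := i) (circle_pt_circle x).
    have [-> _] := ta i => /circle_pt_inj e; have : x = t i; last by lra.
    by apply: e; rewrite ltr_norml; lra.
  have [y yx ez] := circle_ptP (t i) (adm_circle hZ Zz); move: cz; rewrite ez.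
  have [-> _] := ta i; move=> /(@cycP _ (t i)); case.
  - by apply/andP; split; lra.
  - by [].
  - by apply/andP; split; lra.
  - move=> /andP[xy yt]; exists y => //; split; last by rewrite -ez.
    by rewrite xy /=; lra.
  - by move: yx => /andP[? ?] /andP[]; lra.
  - by move: yx => /andP[? ?] /andP[]; lra.
have Eacc (i : 'I_n.+1) m : t i < m < t i.+1 ->
    exists2 e, 0 < e & forall x, E i x -> `|x - m| < e -> x = m.
  move=> tm; have [V Vm VZ] : exists2 V, nbhs (pt m) V &
      forall z, V z -> Z z -> z = pt m.
    have [Zm|nZm] := pselect (Z (pt m)).
      have [_ [V Vm VZ]] := adm_discrete hZ Zm; exists V => // z Vz Zz.
      by have : (V `&` Z) z by []; rewrite VZ.
    have : ~ closure Z (pt m).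
      by move=> cm; apply: (nota _ _ tm); rewrite (adm_limit_points hZ).
    move=> /existsNP[V /not_implyP[Vm ZV0]]; exists V => // z Vz Zz.
    by case: ZV0; exists z.
  have /nbhs_ballP[e /= e0 eV] := circle_pt_continuous Vm.
  exists e => // x [tx Zx] xm; apply: (tnear i); [lra|lra|].
  by apply: VZ => //; apply: eV; rewrite /ball /= distrC.
have ZE z : Z z <-> exists i, exists2 x, E i x & z = pt x.
  split=> [Zz|[i [x [_ Zx] ->//]]].
  have [x xs ez] := circle_ptP (t 0%N) (adm_circle hZ Zz).
  suff [i tx] : exists i : 'I_n.+1, t i < x < t i.+1.
    by exists i, x => //; split; rewrite // -ez.
  (* The interval containing [x] is found by induction on the number of angles [t k] considered. *)
  have main k : (k <= n.+1)%N -> x < t k -> exists2 i, (i < k)%N & t i <= x < t i.+1.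
    elim: k => [|k IHk] kn xk; first by move: xs => /andP[? ?]; lra.
    have [kx|xk'] := leP (t k) x; first by exists k; rewrite ?kx.
    by have [i ik ix] := IHk (ltnW kn) xk'; exists i; rewrite // ltnW.
  have [|i ni /andP[ix xi]] := main n.+1 (leqnn _).
    by rewrite tn; case/andP: xs.
  exists (Ordinal ni); rewrite xi andbT lt_neqAle ix andbT; apply/eqP => eix.
  by apply: (notZ (Ordinal ni)); have [-> _] := ta (Ordinal ni); rewrite /= eix -ez.
(* For a single limit point the interval is [Z] by convention; otherwise its two ends are less than
   one turn apart, and [cyc] becomes an inequality of angles. *)
have IE i z : interval_of Z a i z <-> exists2 x, E i x & z = pt x.
  rewrite /interval_of; case: ifPn => [/eqP n1|n1].
    rewrite ZE; split=> [[j [x Ex ->]]|[x Ex ->]]; last by exists i, x.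
    exists x => //; suff -> : i = j by [].
    by apply: val_inj => /=; have := ltn_ord i; have := ltn_ord j; lia.
  have tin : t i.+1 < t i + 2 * pi.
    have := t0i i; have := ttn i => h1 h2.
    have [i0|i0] := posnP i.
      rewrite i0 -tn.
      by apply: tmono; rewrite ltnS lt0n leqnn andbT; apply: contra n1 => /eqP ->.
    suff : t 0%N < t i by lra.
    by apply: tmono; rewrite i0 ltnW.
  split=> [[cz]|[x [/andP[h1 h2] Zx] ->]]; last first.
    split; first exact: subset_closure.
    have [-> ->] := ta i; exists (t i), x, (t i.+1).
    by split; split=> //; lra.
  have [-> ->] := ta i => ci.
  have zc : circle z by case: ci => [_ [y [_ [_ [_ -> _]]]]]; exact: circle_pt_circle.
  have [x xs ez] := circle_ptP (t i) zc; exists x => //.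
  have tx : t i < x < t i.+1.
    move: ci; rewrite ez => /(@cycP _ (t i)); case.
    - by apply/andP; split; lra.
    - by [].
    - by have := tS i => h; apply/andP; split; lra.
    - by [].
    - by move: xs => /andP[? ?] /andP[]; lra.
    - by have := tS i => h /andP[]; lra.
  split=> //; rewrite -ez; apply/not_notP => nZ.
  by apply: (nota _ _ tx); rewrite (adm_limit_points hZ) -ez.
have [f fP] : {f : 'I_n.+1 -> int -> R & forall i,
    {homo f i : k l / k < l} /\ forall x, E i x <-> exists k, x = f i k}.
  apply: (@choice _ _ (fun i g => {homo g : k l / k < l} /\
    forall x, E i x <-> exists k, x = g k)) => i.
  apply: (@enumerate_int R (E i) (t i) (t i.+1)).
  - have [|y Ey _] := Emax i ((t i + t i.+1) / 2); last by exists y.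
    by have := tS i => h; apply/andP; split; lra.
  - by move=> x [].
  - by move=> x [+ _]; apply: Emax.
  - by move=> x [+ _]; apply: Emin.
  - exact: Eacc.
have fE i k : E i (f i k) by apply/(fP i).2; exists k.
have fr i k : t 0%N <= f i k < t 0%N + 2 * pi.
  have [/andP[h1 h2] _] := fE i k; have := t0i i; have := ttn i => h3 h4.
  by apply/andP; split; lra.
have flt p q : ltpos p q -> f p.1 p.2 < f q.1 q.2.
  case: p q => [i k] [j l]; rewrite /ltpos /=.
  have [/andP[h1 h2] _] := fE i k; have [/andP[h3 h4] _] := fE j l.
  case/orP => [ij|/andP[/eqP/val_inj <- kl]]; last exact: (fP i).1.
  suff : t i.+1 <= t j by lra.
  have [->//|ij1] : i.+1 = j \/ (i.+1 < j)%N by lia.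
  by apply/ltW/tmono; rewrite ij1 /= ltnW.
have ltE p q : (f p.1 p.2 < f q.1 q.2) = ltpos p q.
  apply/idP/idP => [h|]; last exact: flt.
  apply/negPn/negP => npq; have [qp|nqp] := boolP (ltpos q p).
    by have := flt _ _ qp; lra.
  suff e : p = q by rewrite e ltxx in h.
  move: npq nqp; rewrite /ltpos; case: p q {h} => [i k] [j l] /= h1 h2.
  have eij : i = j by apply: val_inj => /=; lia.
  by subst j; congr pair; lia.
exists (fun p => pt (f p.1 p.2)); split.
- move=> p q /circle_pt_inj e.
  have : f p.1 p.2 = f q.1 q.2.
    by apply: e; have := fr p.1 p.2; have := fr q.1 q.2; rewrite ltr_norml; lra.
  have := ltE p q; have := ltE q p => h1 h2 e'; move: h1 h2.
  rewrite e' ltxx /ltpos; case: p q {e e'} => [i k] [j l] /= h1 h2.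
  have eij : i = j by apply: val_inj => /=; lia.
  by subst j; congr pair; lia.
- move=> z; rewrite ZE; split=> [[i [_ /(fP i).2[k ->] ->]]|[p ->]].
    by exists (i, k).
  by exists p.1, (f p.1 p.2).
- move=> i z; rewrite IE; split=> [[x /(fP i).2[k ->] ->]|[k ->]]; first by exists k.
  by exists (f i k).
- move=> [i k] [j l] [h m]; rewrite cycP; try exact: fr.
  by rewrite !ltE /cycpos; split=> [[] ->|/or3P[]->]; rewrite ?orbT //;
    [constructor 1|constructor 2|constructor 3].
Qed.

End Coordinates.

(** * Blocks and cuts *)

(** Reflexive exactly at the indices covered by a block: [same_block P i i] says that the [i]-th
    interval is used by [P]. *)
Definition same_block n (P : nnc n) (i j : 'I_n) : bool :=
  [exists B in nnc_blocks P, (i \in B) && (j \in B)].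

(** The intervals on one side of the limit arc joining the anti-clockwise ends of the intervals [lo]
    and [hi], whence the half-open range. *)
Definition in_cut n (lo hi i : 'I_n) : bool := (lo < i <= hi)%N.

Lemma ex_cut n (P : nnc n) (B B' : {set 'I_n}) (i j : 'I_n) :
  B \in nnc_blocks P -> B' \in nnc_blocks P ->
  i \in B -> j \in B' -> B != B' ->
  exists lo hi : 'I_n, [/\ (lo < hi)%N, in_cut lo hi i != in_cut lo hi j &
    forall k l, same_block P k l -> in_cut lo hi k = in_cut lo hi l].
Proof.
move=> BP B'P iB jB' neB.
have /and3P[_ _ /noncrossingP nc] := nncP P.
(* A cut between two consecutive elements of [B], or between the extreme ones,
   does not split any block. *)
wlog ij : B B' i j BP B'P iB jB' neB / (i < j)%N.
  move=> W; have [ij|ji|ij] := ltngtP i j; first exact: (W B B' i j).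
    have [||||||lo [hi [h1 h2 h3]]] := W B' B j i => //; first by rewrite eq_sym.
    by exists lo, hi; rewrite eq_sym.
  by case/eqP: neB; apply: nnc_block_eq BP B'P iB _; rewrite (val_inj ij).
have jB : j \notin B by apply: contra neB => jB; apply/eqP/(nnc_block_eq BP B'P jB).
have blk D k : D \in nnc_blocks P -> k \in D -> k \in B -> D = B.
  by move=> DP kD kB; apply: nnc_block_eq DP BP kD kB.
(* Two checks suffice for a cut: only [B] could have elements on both sides, and [B] does not. *)
have compat lo hi : (forall D k m, D \in nnc_blocks P -> k \in D -> m \in D ->
      in_cut lo hi k -> ~~ in_cut lo hi m -> D = B) ->
    (forall k m, k \in B -> m \in B -> in_cut lo hi k -> in_cut lo hi m) ->
    forall k m, same_block P k m -> in_cut lo hi k = in_cut lo hi m.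
  move=> H HB.
  have imp D k m : D \in nnc_blocks P -> k \in D -> m \in D ->
      in_cut lo hi k -> in_cut lo hi m.
    move=> DP kD mD ck; apply: contraT => nm; have eD := H D k m DP kD mD ck nm.
    by move: nm; rewrite (HB k m) // -eD.
  by move=> k m /exists_inP[D DP /andP[kD mD]]; apply/idP/idP; apply: (imp D).
pose Pl b := (b \in B) && (b < j)%N.
have Pli : Pl i by rewrite /Pl iB ij.
have [l /andP[lB lj] lmax] := @arg_maxnP _ i Pl val Pli.
have {Pli}il : (i <= l)%N by apply: lmax.
pose Pr b := (b \in B) && (j < b)%N.
(* If [B] has elements beyond [j], the cut is the gap between its neighbours [l] and [r] of [j];
   upper bounds of cuts are included, hence [r.-1]. *)
have [/existsP[r0 Pr0]|nr] := boolP [exists b, Pr b].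
  have [r /andP[rB jr] rmin] := @arg_minnP _ r0 Pr val Pr0.
  have rn : (r.-1 < n)%N by have := ltn_ord r; clear; lia.
  have cutE k : in_cut l (Ordinal rn) k = (l < k < r)%N.
    by rewrite /in_cut /=; clear -jr; lia.
  have notB k : k \in B -> ~~ (l < k < r)%N.
    move=> kB; have [kj|jk|kj] := ltngtP k j.
    - by have := lmax k; rewrite /Pl kB kj /= => /(_ isT) h; clear -h; lia.
    - by have := rmin k; rewrite /Pr kB jk /= => /(_ isT) h; clear -h; lia.
    - by rewrite -(val_inj kj) kB in jB.
  exists l, (Ordinal rn); split; first by rewrite /=; clear -lj jr; lia.
    by rewrite !cutE; clear -il lj jr; lia.
  apply: compat => [D k m DP kD mD|k m kB _]; rewrite !cutE; last first.
    by rewrite (negPf (notB _ kB)).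
  move=> /andP[lk kr]; rewrite negb_and -!leqNgt => /orP[]; rewrite leq_eqVlt.
    case/predU1P=> [/val_inj ml|ml]; first by apply: blk DP mD _; rewrite ml.
    exact: (nc D B DP BP m l k r).
  case/predU1P=> [/val_inj rm|rm]; first by apply: blk DP mD _; rewrite -rm.
  by apply/esym; apply: (nc B D BP DP l k r m).
have maxB b : b \in B -> (b <= l)%N.
  move=> bB; have [bj|jb|bj] := ltngtP b j.
  - by apply: lmax; rewrite /Pl bB.
  - by case/existsP: nr; exists b; rewrite /Pr bB.
  - by rewrite -(val_inj bj) bB in jB.
(* Otherwise [B] lies between its least element [f] and its greatest element [l], and the cut
   separates the range from [f] to [l] from its complement. *)
have [f fB fmin] := @arg_minnP _ i (mem B) val iB.
have fi : (f <= i)%N by apply: fmin.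
have ends D k : D \in nnc_blocks P -> k \in D -> D != B -> k != f :> nat /\ k != l :> nat.
  move=> DP kD nD; split; apply: contra nD => /eqP/val_inj ek;
  by apply/eqP/(blk D k) => //; rewrite ek.
(* For [f = 0] the excluded lower bound [f.-1] would not lie below [f]; the complementary range,
   from [l] to the last index, is used instead. *)
have [f0|f0] := posnP f.
  have ln : (n.-1 < n)%N by have := ltn_ord j; clear; lia.
  have cutE k : in_cut l (Ordinal ln) k = (l < k)%N.
    by rewrite /in_cut /=; have := ltn_ord k; clear; lia.
  exists l, (Ordinal ln); split; first by rewrite /=; have := ltn_ord j; clear -lj; lia.
    by rewrite !cutE; clear -il lj; lia.
  apply: compat => [D k m DP kD mD|k m kB _]; rewrite !cutE; last first.
    by rewrite ltnNge maxB.
  move=> lk ml; apply/eqP/negPn/negP => nD; have [mf ml'] := ends D m DP mD nD.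
  have {}ml : (m <= l)%N by rewrite leqNgt.
  case/eqP: nD; apply/esym; apply: (nc B D BP DP f m l k) => //.
    by rewrite ltn_neqAle eq_sym mf f0.
  by rewrite ltn_neqAle ml'.
have fn : (f.-1 < n)%N by have := ltn_ord f; clear; lia.
have cutE k : in_cut (Ordinal fn) l k = (f <= k <= l)%N.
  by rewrite /in_cut /=; clear -f0; lia.
exists (Ordinal fn), l; split; first by rewrite /=; clear -f0 fi il; lia.
  by rewrite !cutE; clear -fi il lj; lia.
apply: compat => [D k m DP kD mD|k m _ mB _]; rewrite cutE; last first.
  by rewrite (fmin _ mB) maxB.
move=> /andP[fk kl]; rewrite cutE => mcut; apply/eqP/negPn/negP => nD.
have [kf kl'] := ends D k DP kD nD.
have [mf|fm] := ltnP m f.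
  by case/eqP: nD; apply: (nc D B DP BP m f k l); rewrite // ltn_neqAle ?kl' // eq_sym kf.
case/eqP: nD; apply/esym; apply: (nc B D BP DP f k l m) => //.
- by rewrite ltn_neqAle eq_sym kf.
- by rewrite ltn_neqAle kl'.
- by move: mcut; rewrite fm /= -ltnNge.
Qed.

(** * Arcs in coordinates *)

Lemma set2_eq (T : Type) (x y z w : T) :
  [set x; y] = [set z; w] -> (x = z /\ y = w) \/ (x = w /\ y = z).
Proof.
move=> e; have x_zw : [set z; w] x by rewrite -e; left.
have y_zw : [set z; w] y by rewrite -e; right.
have z_xy : [set x; y] z by rewrite e; left.
have w_xy : [set x; y] w by rewrite e; right.
by case: x_zw y_zw z_xy w_xy => [] ? [] ? [] ? [] ?; subst; auto.
Qed.

Definition shift n (d : int) (p : pos n) : pos n := (p.1, p.2 + d).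

(** Points of different intervals are never neighbours, because an interval has neither a first nor
    a last point. *)
Definition arcpos n (p q : pos n) : bool :=
  [|| val p.1 != val q.1, p.2 + 1 < q.2 | q.2 + 1 < p.2].

Definition crosspos n (p q r s : pos n) : bool :=
  (cycpos p r q && cycpos q s p) || (cycpos p s q && cycpos q r p).

Lemma crossposCl n (p q r s : pos n) : crosspos q p r s = crosspos p q r s.
Proof. by rewrite /crosspos orbC andbC [X in _ || X]andbC. Qed.

Lemma crossposCr n (p q r s : pos n) : crosspos p q s r = crosspos p q r s.
Proof. by rewrite /crosspos orbC. Qed.

Lemma pos_eq n (p q : pos n) : p = q <-> p.1 = q.1 :> nat /\ p.2 = q.2.
Proof.
by case: p q => [i k] [j l] /=; split=> [[-> ->]|[/val_inj -> ->]].
Qed.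

(** In coordinates every statement on shifts, arcs and crossings is linear arithmetic over interval
    indices and integers. *)
Ltac poslia :=
  rewrite /crosspos /cycpos /ltpos /arcpos /shift; intros;
  repeat match goal with p : pos _ |- _ => destruct p as [[? ?] ?] end;
  simpl in *; lia.

Lemma arcpos_shift n d (p q : pos n) : arcpos (shift d p) (shift d q) = arcpos p q.
Proof. by poslia. Qed.

Section ArcCoordinates.
Variables (R : realType) (Z : set (R * R)) (n : nat) (a : 'I_n -> R * R).
Variable e : pos n -> R * R.
Hypothesis e_inj : injective e.
Hypothesis ZE : forall z, Z z <-> exists p, z = e p.
Hypothesis cycE : forall p q r, cyc (e p) (e q) (e r) <-> cycpos p q r.
Implicit Types p q r s : pos n.

Let Ze p : Z (e p). Proof. by apply/ZE; exists p. Qed.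

Lemma is_succE p q : is_succ Z (e p) (e q) <-> q = shift 1 p.
Proof.
split=> [[_ qp nc]|->].
  apply/pos_eq; have /cycE := nc _ (Ze (shift 1 p)) => /negP.
  have : ~ (p.1 = q.1 :> nat /\ p.2 = q.2) by move/pos_eq => pq; rewrite pq in qp.
  by clear; poslia.
split=> //; first by move/e_inj/pos_eq; clear; poslia.
by move=> _ /ZE[r ->] /cycE; clear; poslia.
Qed.

Lemma zsuccE p : zsucc Z (e p) = e (shift 1 p).
Proof.
have ep : [set w | is_succ Z (e p) w] (e (shift 1 p)) by apply/is_succE.
have := xgetI (e p) ep => h; have [/ZE[q eq] _ _] := h.
by move: h; rewrite /zsucc eq => /is_succE ->.
Qed.

Lemma zpredE p : zpred Z (e p) = e (shift (-1) p).
Proof.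
have ep : [set w | Z w /\ is_succ Z w (e p)] (e (shift (-1) p)).
  by split=> //; apply/is_succE/pos_eq; clear; poslia.
have := xgetI (e p) ep => h; have [/ZE[q eq] _] := h.
move: h => [_]; rewrite /zpred eq => /is_succE/pos_eq h.
by congr e; apply/pos_eq; move: h; clear; poslia.
Qed.

Lemma is_arcE p q : is_arc Z [set e p; e q] <-> arcpos p q.
Proof.
split=> [[_ [_ [/ZE[r ->] /ZE[s ->] rs]]]|pq].
  rewrite zpredE zsuccE => -[h1 h2 h3].
  have {}rs : (r = p /\ s = q) \/ (r = q /\ s = p).
    by have := set2_eq rs; case=> -[/e_inj -> /e_inj ->]; auto.
  have {}h1 : ~ (s = shift (-1) r) by move=> h; apply: h1; rewrite h.
  have {}h2 : ~ (s = r) by move=> h; apply: h2; rewrite h.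
  have {}h3 : ~ (s = shift 1 r) by move=> h; apply: h3; rewrite h.
  by move: rs h1 h2 h3; rewrite !pos_eq; clear; poslia.
exists (e p), (e q); split=> //; rewrite zpredE zsuccE.
by split=> /e_inj/pos_eq; move: pq; clear; poslia.
Qed.

Lemma cyc4E p q r s : cyc4 (e p) (e q) (e r) (e s) <-> cycpos p q r && cycpos r s p.
Proof.
split=> [[]|]; rewrite ?cycE; first by clear; poslia.
by move=> h; split; rewrite cycE; move: h; clear; poslia.
Qed.

Lemma crossE p q r s :
  cross [set e p; e q] [set e r; e s] <-> crosspos p q r s.
Proof.
split=> [[y0 [y1 [y2 [y3 [e1 e2 h]]]]]|h].
  have h1 := set2_eq e1; have h2 := set2_eq e2; move: h.
  have [p' [q' [-> -> h1']]] : exists p' q', [/\ y0 = e p', y1 = e q' &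
      (p' = p /\ q' = q) \/ (p' = q /\ q' = p)].
    by case: h1 => -[<- <-]; [exists p, q|exists q, p]; split; auto.
  have [r' [s' [-> -> h2']]] : exists p' q', [/\ y2 = e p', y3 = e q' &
      (p' = r /\ q' = s) \/ (p' = s /\ q' = r)].
    by case: h2 => -[<- <-]; [exists r, s|exists s, r]; split; auto.
  rewrite !cyc4E => h; have : crosspos p' q' r' s' by apply/orP.
  by case: h1' => -[-> ->]; case: h2' => -[-> ->];
    [|rewrite crossposCr|rewrite crossposCl|rewrite crossposCl crossposCr].
exists (e p), (e q), (e r), (e s); split=> //; rewrite !cyc4E.
by case/orP: h; [left|right].
Qed.

Lemma cyc_leE p q r : cyc_le (e p) (e q) (e r) <-> [\/ q = p, q = r | cycpos p q r].
Proof.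
split=> [[/e_inj->|/e_inj->|/cycE h]|[->|->|/cycE h]].
- exact: Or31.
- exact: Or32.
- exact: Or33.
- exact: Or31.
- exact: Or32.
- exact: Or33.
Qed.

(** * Arc objects and the maps between them *)

Section ArcObjects.
Variables (K : fieldType) (C : discrete_cluster_category Z K).

Definition obj p q : C := arc_obj C [set e p; e q].

Lemma objC p q : obj p q = obj q p. Proof. by rewrite /obj setUC. Qed.

Lemma obj_surj (X : C) : indecomposable X ->
  exists p q, arcpos p q /\ isomorphic X (obj p q).
Proof.
move=> /arc_obj_surj[A Aarc XA]; have [_ [_ [/ZE[p ->] /ZE[q ->] eA _]]] := Aarc.
by exists p, q; rewrite /obj -eA -is_arcE -eA.
Qed.

Lemma obj_susp p q : arcpos p q ->
  isomorphic (susp (obj p q)) (obj (shift (-1) p) (shift (-1) q)).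
Proof. by move=> /is_arcE/(dcc_susp C); rewrite !zpredE. Qed.

Lemma obj_desusp p q : arcpos p q ->
  isomorphic (susp (obj (shift 1 p) (shift 1 q))) (obj p q).
Proof.
have sK r : shift (-1) (shift 1 r) = r by apply/pos_eq; clear; poslia.
move=> pq; rewrite -{2}(sK p) -{2}(sK q).
by apply: obj_susp; rewrite arcpos_shift.
Qed.

(** Crossings govern maps into a suspension; [obj r s] is the suspension of the arc moved by one,
    hence the shift in the crossing condition. *)
Lemma hom_obj_eq0 p q r s (f : Hom (obj p q) (obj r s)) :
  arcpos p q -> arcpos r s -> ~~ crosspos p q (shift 1 r) (shift 1 s) -> f = 0.
Proof.
move=> pq rs /negP nc; have [g gi] := isomorphic_sym (obj_desusp rs).
apply: (iso_comp_eq0 gi); apply: dcc_hom_noncross => //;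
  by rewrite ?is_arcE ?crossE ?arcpos_shift.
Qed.

Let hom_obj_dim1 p q r s :
  arcpos p q -> arcpos r s -> crosspos p q (shift 1 r) (shift 1 s) ->
  exists2 f : Hom (obj p q) (obj r s), f <> 0 & forall g, exists c, g = c *: f.
Proof.
move=> pq rs pqrs; have [g [h [hg gh]]] := obj_desusp rs.
have [|||phi [phi' phiK Kphi]] :=
    @dcc_hom_cross _ _ _ C [set e p; e q] [set e (shift 1 r); e (shift 1 s)].
- exact/is_arcE.
- by apply/is_arcE; rewrite arcpos_shift.
- exact/crossE.
exists (g \*c phi 1).
  move=> g0; have := iso_comp_eq0 (ex_intro _ h (conj hg gh)) g0.
  rewrite -(raddf0 phi) => /(can_inj phiK)/eqP; apply/negP; exact: oner_neq0.
move=> k; exists (phi' (h \*c k)).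
rewrite -compmZr -[_ *: phi 1]linearZ_LR /=.
have -> : phi' (h \*c k) *: (1 : K^o) = phi' (h \*c k) by rewrite /GRing.scale /= mulr1.
by rewrite Kphi comp_assoc gh comp_idl.
Qed.

Lemma hom_obj_neq0 p q r s :
  arcpos p q -> arcpos r s -> crosspos p q (shift 1 r) (shift 1 s) ->
  exists f : Hom (obj p q) (obj r s), f <> 0.
Proof. by move=> pq rs /hom_obj_dim1[]// f f0 _; exists f. Qed.

Lemma hom_obj_scale p q r s (f g : Hom (obj p q) (obj r s)) :
  arcpos p q -> arcpos r s -> f <> 0 -> exists c, g = c *: f.
Proof.
move=> pq rs f0; have [/hom_obj_dim1[]// k _ kP|/hom_obj_eq0 nc] :=
  boolP (crosspos p q (shift 1 r) (shift 1 s)); last by case: f0; apply: nc.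
have [b fb] := kP f; have [c gc] := kP g; exists (c / b); rewrite gc fb scalerA.
have [b0|b0] := eqVneq b 0; last by rewrite divfK.
by case: f0; rewrite fb b0 scale0r.
Qed.

Lemma obj_inj p q r s : arcpos p q -> arcpos r s ->
  isomorphic (obj p q) (obj r s) -> (p = r /\ q = s) \/ (p = s /\ q = r).
Proof.
move=> /is_arcE pq /is_arcE rs pqrs.
by have [] := set2_eq (arc_obj_inj pq rs pqrs) => -[/e_inj -> /e_inj ->]; auto.
Qed.

(** The endpoints are ordered, so that [Q] may treat them differently. Closure under isomorphism is
    built in because suspensions of arc objects are known only up to isomorphism. *)
Definition arc_class (Q : pos n -> pos n -> Prop) : set C :=
  [set X | exists p q, [/\ arcpos p q, Q p q & isomorphic X (obj p q)]].

Definition arc_mor (Q : pos n -> pos n -> pos n -> pos n -> Prop) (X Y : C)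
    (h : Hom X Y) : Prop :=
  h <> 0 /\ exists p q r s, [/\ arcpos p q, arcpos r s, Q p q r s,
    isomorphic X (obj p q) & isomorphic Y (obj r s)].

Lemma arc_class_obj (Q : pos n -> pos n -> Prop) p q :
  arcpos p q -> Q p q -> arc_class Q (obj p q).
Proof. by move=> pq Qpq; exists p, q; split=> //; apply: isomorphic_refl. Qed.

Section Stable.
Variables (Q : pos n -> pos n -> Prop) (Q' : pos n -> pos n -> pos n -> pos n -> Prop).
Hypothesis Q_shift : forall d p q, Q p q -> Q (shift d p) (shift d q).
Hypothesis Q'_shift : forall d p q r s,
  Q' p q r s -> Q' (shift d p) (shift d q) (shift d r) (shift d s).

Lemma ind_orth_arc_thick : is_thick (ind_orth (arc_class Q) (arc_mor Q')).
Proof.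
have iso_susp X p q : arcpos p q -> isomorphic X (obj p q) ->
    isomorphic (susp X) (obj (shift (-1) p) (shift (-1) q)).
  by move=> pq /isomorphic_susp Xpq; apply: isomorphic_trans Xpq _; apply: obj_susp.
apply: ind_orth_thick.
- move=> X [p [q [pq Qpq Xpq]]]; exists (shift (-1) p), (shift (-1) q).
  by rewrite arcpos_shift; split=> //; [apply: Q_shift|apply: iso_susp].
- move=> X [p [q [pq Qpq Xpq]]]; exists (obj (shift 1 p) (shift 1 q)).
    by apply: arc_class_obj; rewrite ?arcpos_shift //; apply: Q_shift.
  by apply: isomorphic_trans Xpq _; apply/isomorphic_sym/obj_desusp.
- move=> X Y X' Y' t h s ti si [h0 [p [q [r [u [pq ru Qpqru Xpq Yru]]]]]].
  split; first by move=> /(comp_iso_eq0 ti)/(iso_comp_eq0 si).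
  exists p, q, r, u; split=> //.
    by apply: isomorphic_trans Xpq; exists t.
  by apply: isomorphic_trans Yru; apply: isomorphic_sym; exists s.
- move=> X Y h; split=> -[h0 [p [q [r [u [pq ru Qpqru Xpq Yru]]]]]]; split.
  + by move=> e0; apply: h0; rewrite e0 raddf0.
  + exists (shift 1 p), (shift 1 q), (shift 1 r), (shift 1 u).
    rewrite !arcpos_shift; split=> //; first exact: Q'_shift.
      apply: isomorphic_susp_inj; apply: isomorphic_trans Xpq _.
      exact/isomorphic_sym/obj_desusp.
    apply: isomorphic_susp_inj; apply: isomorphic_trans Yru _.
    exact/isomorphic_sym/obj_desusp.
  + by move/susp_mor_eq0.
  + exists (shift (-1) p), (shift (-1) q), (shift (-1) r), (shift (-1) u).
    by rewrite !arcpos_shift; split=> //; [apply: Q'_shift|apply: iso_susp..].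
Qed.

Lemma ind_orth_arcPn p q r s : arcpos p q -> arcpos r s ->
  crosspos p q (shift 1 r) (shift 1 s) -> Q r s -> Q' p q r s ->
  ~ ind_orth (arc_class Q) (arc_mor Q') (obj p q).
Proof.
move=> pq rs cr Qrs Qpqrs; have [f f0] := hom_obj_neq0 pq rs cr.
apply: (@ind_orthPn _ _ _ (arc_mor Q') _ _ (obj r s) f).
- by move=> X Y h [].
- split=> //; exists p, q, r, s; split=> //; exact: isomorphic_refl.
- exact: arc_class_obj.
Qed.

(** Isomorphisms with arc objects are absorbed, so it is enough to find, for each arc of the class,
    one preserving map that kills all maps from [obj p q]. *)
Lemma ind_orth_arcP p q : arcpos p q ->
  (forall r s, arcpos r s -> Q r s -> exists Y (g : Hom (obj r s) Y),
     [/\ arc_class Q Y, preserving (arc_mor Q') g &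
         forall f : Hom (obj p q) (obj r s), g \*c f = 0]) ->
  ind_orth (arc_class Q) (arc_mor Q') (obj p q).
Proof.
move=> pq H X f [r [s [rs Qrs [i ii]]]]; have [Y [g [QY pg gf]]] := H r s rs Qrs.
exists Y, (g \*c i); split=> //; last by rewrite -comp_assoc gf.
apply: preserving_comp pg _ => W h [h0 [p' [q' [r' [s' [pq' rs' Q4 Wp Xr]]]]]].
split; first by move/(iso_comp_eq0 ii).
exists p', q', r', s'; split=> //.
by apply: isomorphic_trans Xr; apply: isomorphic_sym; exists i.
Qed.

End Stable.

(** * Orthogonality to the arcs inside one interval *)

Definition inner_orth (i : 'I_n) : set C :=
  ind_orth (arc_class (fun p q => p.1 = i /\ q.1 = i)) (arc_mor (fun _ _ _ _ => True)).

Lemma inner_orth_thick i : is_thick (inner_orth i).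
Proof. exact: ind_orth_arc_thick. Qed.

Lemma inner_orth_obj i p q : arcpos p q -> p.1 != i -> q.1 != i ->
  inner_orth i (obj p q).
Proof.
(* An arc without an end in the interval crosses no arc inside it, so all maps vanish already and
   the identity serves. *)
move=> pq pi qi; apply: ind_orth_arcP => // r s rs Qrs; exists (obj r s), (idm _).
split; [exact: arc_class_obj|exact: preserving_id|move=> f].
rewrite comp_idl; apply: hom_obj_eq0 => //.
case: Qrs => /(congr1 val) ri /(congr1 val) si.
move: pi qi ri si; rewrite -!(inj_eq val_inj) => pi qi ri si.
by move: pi qi ri si; rewrite /=; clear; poslia.
Qed.

Lemma inner_orthPn p q : arcpos p q -> ~ inner_orth p.1 (obj p q).
Proof.
(* Shifted by one, the witness joins the two neighbours of [p], hence crosses every arc ending at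
   [p]. *)
move=> pq; apply: (@ind_orth_arcPn _ _ p q (shift (-2) p) p) => //.
  by clear; poslia.
by move: pq; clear; poslia.
Qed.

(** * Orthogonality to a limit arc *)

Section Cut.
Variables lo hi : 'I_n.
Hypothesis lohi : (lo < hi)%N.

Definition cut_class p q : Prop := p.1 = lo /\ q.1 = hi.

(* The last condition excludes the arcs with endpoints beyond [r] and [s]: they
   also map to [obj r s], but these maps die when [r] and [s] move past them. *)
Definition cut_mor p q r s : Prop :=
  [/\ ~~ in_cut lo hi p.1, in_cut lo hi q.1, r.1 = lo, s.1 = hi &
      (p.1 = lo -> p.2 <= r.2) /\ (q.1 = hi -> q.2 <= s.2)].

Definition cut_orth : set C := ind_orth (arc_class cut_class) (arc_mor cut_mor).

Let cut_arc (s t : int) : arcpos (lo, s) (hi, t).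
Proof. by rewrite /arcpos /= ltn_eqF. Qed.

Lemma cut_orth_thick : is_thick cut_orth.
Proof.
apply: ind_orth_arc_thick => // d p q r s [? ? ? ? [h1 h2]]; split=> //=.
by rewrite !lerD2r.
Qed.

Lemma cut_orthPn p q : arcpos p q ->
  ~~ in_cut lo hi p.1 -> in_cut lo hi q.1 -> ~ cut_orth (obj p q).
Proof.
(* Reusing the integers of [p] and [q] makes the bounds in [cut_mor] equalities whenever they
   apply. *)
move=> pq pc qc; apply: (@ind_orth_arcPn _ _ p q (lo, p.2) (hi, q.2)) => //.
move: lohi pc qc; case: p q {pq} => [i k] [j l].
by rewrite /in_cut /crosspos /cycpos /ltpos /shift /=; clear; lia.
Qed.

(** Prepares [dcc_factor]: the second item is its crossing condition for maps from [obj p q] to the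
    farther arc, and the last two place the nearer arc on the way. *)
Lemma cut_cross (s s' t t' : int) p q :
  s <= s' -> t <= t' -> cut_mor p q (lo, s) (hi, t) ->
  [/\ crosspos p q (shift 1 (lo, s)) (shift 1 (hi, t)),
      cycpos p (shift 1 (lo, s')) q && cycpos q (shift 1 (hi, t')) p,
      [\/ (lo, s) = p, (lo, s) = (lo, s') | cycpos p (lo, s) (lo, s')] &
      [\/ (hi, t) = q, (hi, t) = (hi, t') | cycpos q (hi, t) (hi, t')]].
Proof.
case: p q => [i k] [j l] ss' tt' [/= pc qc _ _ [ks lt]].
have {}ks : val i = val lo -> k <= s by move/val_inj.
have {}lt : val j = val hi -> l <= t by move/val_inj.
move: lohi pc qc ks lt ss' tt'.
rewrite /in_cut /crosspos /cycpos /ltpos /shift /= => h1 h2 h3 ks lt ss' tt'.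
split; [by lia|by lia| |].
- have [->|ns] := eqVneq s s'; first exact: Or32.
  have [|nik] := boolP ((val i == lo) && (k == s)).
    by move=> /andP[/eqP ei /eqP ->]; apply: Or31; apply/pos_eq.
  by apply: Or33; move: nik; rewrite /=; lia.
- have [->|ns] := eqVneq t t'; first exact: Or32.
  have [|nik] := boolP ((val j == hi) && (l == t)).
    by move=> /andP[/eqP ei /eqP ->]; apply: Or31; apply/pos_eq.
  by apply: Or33; move: nik; rewrite /=; lia.
Qed.

(** A nonzero map from [obj p q] to the farther arc factors through the nearer one. As Hom spaces
    are at most one-dimensional, the factors are multiples of [g] and of the given map, whose
    composite is therefore nonzero. *)
Lemma cut_preserving (s t s' t' : int)
    (g : Hom (obj (lo, s) (hi, t)) (obj (lo, s') (hi, t'))) :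
  s <= s' -> t <= t' -> g <> 0 -> preserving (arc_mor cut_mor) g.
Proof.
move=> ss' tt' g0 X h [h0 [p [q [r [u [pq ru Q [k ki] Yru]]]]]].
(* The target of [h] determines its arc; the exchange of its two ends is excluded by [lo < hi]. *)
have {r u ru Yru Q} Q : cut_mor p q (lo, s) (hi, t).
  have [[-> ->]//|[er eu]] := obj_inj (cut_arc s t) ru Yru.
  by case: Q => _ _ + + _; rewrite -er -eu /= => e1; have := lohi; rewrite e1 ltnn.
have [cr cr' c1 c2] := cut_cross ss' tt' Q.
have [k' [k'k kk']] := ki.
pose h' : Hom (obj p q) (obj (lo, s) (hi, t)) := h \*c k'.
have h'0 : h' <> 0.
  by move=> e0; apply: h0; rewrite -(comp_idr h) -k'k comp_assoc -/h' e0 comp0m.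
split=> [gh|]; last first.
  exists p, q, (lo, s'), (hi, t'); split=> //; first 1 last.
  - by exists k.
  - exact: isomorphic_refl.
  case: Q => h1 h2 _ _ [h3 h4]; split=> //=; split=> [/h3|/h4] /= h5.
    exact: le_trans h5 ss'.
  exact: le_trans h5 tt'.
have gh' : g \*c h' = 0 by rewrite comp_assoc gh comp0m.
have [|f f0] := hom_obj_neq0 pq (cut_arc s' t'); first by rewrite /crosspos cr'.
have [] := @dcc_factor _ _ _ C _ _ _ _ _ _ _ f f0 [set e (lo, s); e (hi, t)] _.
- exact/is_arcE.
- exact/is_arcE.
- by rewrite !zsuccE; apply/cyc4E.
- exact/is_arcE.
move=> _ []; first by exists (e (lo, s)), (e (hi, t)); split=> //; apply/cyc_leE.
move=> g' [h'' fE]; apply: f0; rewrite fE.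
have [b ->] := hom_obj_scale g' (cut_arc s t) (cut_arc s' t') g0.
have [c ->] := hom_obj_scale h'' pq (cut_arc s t) h'0.
by rewrite compmZl compmZr gh' !scaler0.
Qed.

Lemma cut_orth_obj p q : arcpos p q -> in_cut lo hi p.1 = in_cut lo hi q.1 ->
  cut_orth (obj p q).
Proof.
move=> pq pqc; apply: ind_orth_arcP => // -[lo' s] [hi' t] rs [/= e1 e2].
(* The target moves along the class until both its ends are beyond those of [p] and [q]; an arc with
   both ends on one side of the cut then no longer crosses it. *)
subst lo' hi'; pose s' := Num.max s (Num.max p.2 q.2).
pose t' := Num.max t (Num.max p.2 q.2).
have [[ss' ps' qs'] [tt' pt' qt']] : [/\ s <= s', p.2 <= s' & q.2 <= s'] /\
    [/\ t <= t', p.2 <= t' & q.2 <= t'].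
  by rewrite /s' /t' !le_max !lexx !orbT.
have [|g g0] := hom_obj_neq0 (cut_arc s t) (cut_arc s' t').
  by rewrite /crosspos /cycpos /ltpos /shift /=; move: lohi ss' tt'; clear; lia.
exists (obj (lo, s') (hi, t')), g; split=> [||f].
- exact: arc_class_obj.
- exact: cut_preserving.
apply: hom_obj_eq0 => //; move: lohi pqc ps' qs' pt' qt'; clear.
case: p q s' t' => [i k] [j l] s' t'.
rewrite /in_cut /crosspos /cycpos /ltpos /shift /=; lia.
Qed.

End Cut.

(** * The subcategories attached to partitions *)

Hypothesis IE : forall i z, interval_of Z a i z <-> exists k, z = e (i, k).
Implicit Types P : nnc n.

Lemma partition_arcsE P p q : partition_arcs Z a P [set e p; e q] <->
  arcpos p q /\ same_block P p.1 q.1.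
Proof.
have IB (B : {set 'I_n}) r :
    (\bigcup_(i in [set` B]) interval_of Z a i) (e r) <-> r.1 \in B.
  split=> [[i iB /IE[k /e_inj ->]]//|rB]; exists r.1 => //.
  by apply/IE; exists r.2; case: r {rB}.
split=> [[y0 [y1 [E arc [B BP [y0B y1B]]]]]|[pq /exists_inP[B BP /andP[pB qB]]]].
  move/is_arcE: arc => arc; split=> //; apply/exists_inP; exists B => //.
  by case: (set2_eq E) => -[ep eq]; rewrite -ep -eq in y0B y1B;
    move/IB: y0B => y0B; move/IB: y1B => y1B; apply/andP.
exists (e p), (e q); split=> //; first exact/is_arcE.
by exists B => //; split; apply/IB.
Qed.

(** Either an end of the arc lies in an interval of no block, and [inner_orth] separates, or the
    ends belong to two different blocks, and [ex_cut] provides a limit arc between them. *)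
Lemma separating_thick P p q : arcpos p q -> ~~ same_block P p.1 q.1 ->
  exists T : set C, [/\ is_thick T, ~ T (obj p q) &
    forall r s, arcpos r s -> same_block P r.1 s.1 -> T (obj r s)].
Proof.
move=> pq npq.
have inner i : ~~ same_block P i i ->
    forall r s, arcpos r s -> same_block P r.1 s.1 -> inner_orth i (obj r s).
  move=> ni r s rs /exists_inP[B BP /andP[rB sB]].
  by apply: inner_orth_obj => //; apply: contra ni => /eqP <-;
    apply/exists_inP; exists B; rewrite ?rB ?sB.
have [/exists_inP[B BP /andP[pB _]]|np] := boolP (same_block P p.1 p.1); last first.
  by exists (inner_orth p.1); split;
    [exact: inner_orth_thick|exact: inner_orthPn|exact: inner].
have [/exists_inP[B' B'P /andP[qB' _]]|nq] := boolP (same_block P q.1 q.1); last first.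
  exists (inner_orth q.1); split; [exact: inner_orth_thick| |exact: inner].
  by rewrite objC; apply: inner_orthPn; move: pq; clear; poslia.
have neB : B != B'.
  by apply: contra npq => /eqP eB; apply/exists_inP; exists B; rewrite // pB eB qB'.
have [lo [hi [lohi cpq cP]]] := ex_cut BP B'P pB qB' neB.
exists (cut_orth lo hi); split; first exact: cut_orth_thick.
  (* [cut_orthPn] expects the second end inside the cut, so the ends are exchanged if necessary. *)
  have [qc|qc] := boolP (in_cut lo hi q.1).
    by apply: cut_orthPn => //; move: cpq; rewrite qc; case: in_cut.
  have qp : arcpos q p by move: pq; clear; poslia.
  by rewrite objC; apply: cut_orthPn => //; move: cpq; rewrite (negPf qc); case: in_cut.
by move=> r s rs rsP; apply: cut_orth_obj => //; apply: cP.
Qed.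

Lemma partition_arcs_image_sub P (U : set C) :
  (forall r s, arcpos r s -> same_block P r.1 s.1 -> U (obj r s)) ->
  arc_obj C @` partition_arcs Z a P `<=` U.
Proof.
move=> PU _ [A + <-] => -[y0 [y1 [E arc bB]]].
have [_ [_ [/ZE[r ->] /ZE[s ->] eA _]]] := arc; rewrite eA.
have : partition_arcs Z a P [set e r; e s] by rewrite -eA; exists y0, y1.
by move=> /partition_arcsE[]; apply: PU.
Qed.

(** For the inclusion of the intersection, Krull-Schmidt reduces to arc objects, and an arc outside
    the blocks is excluded by its separating subcategory. *)
Lemma partition_subcatE P : partition_subcat C a P =
  \bigcap_(T in [set T | is_thick T /\ arc_obj C @` partition_arcs Z a P `<=` T]) T.
Proof.
apply/seteqP; split=> [X hX T [Tt PT]|].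
  by apply: hX PT; apply: thick_add_closed.
apply: (krull_schmidt_sub (@tcat_dsums _ C) (@dcc_krull_schmidt _ _ _ C)).
- split=> [m Y X dX hY T TP|X Y sYX hX T TP].
    have [[h _] _ _ _] := TP.1; apply: (h _ _ _ dX) => k; exact: hY.
  by have [[_ h] _ _ _] := TP.1; apply: (h _ _ sYX); exact: hX.
- exact: add_hull_closed.
move=> X /obj_surj[p [q [pq Xpq]]] hX.
have hpq T : is_thick T -> arc_obj C @` partition_arcs Z a P `<=` T -> T (obj p q).
  by move=> Tt PT; apply: (thick_iso Tt (isomorphic_sym Xpq)); apply: hX.
apply: (add_closed_iso (add_hull_closed _) Xpq) => T Tc; apply.
exists [set e p; e q] => //; apply/partition_arcsE; split=> //.
apply: contraT => /(separating_thick pq)[U [Ut nU PU]]; case: nU.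
by apply: hpq => //; apply: partition_arcs_image_sub.
Qed.

Lemma partition_subcat_thick P : is_thick (partition_subcat C a P).
Proof.
rewrite partition_subcatE.
have := thick_bigcap_subproof
  [set T : thick C | arc_obj C @` partition_arcs Z a P `<=` thick_set T].
congr is_thick; apply/seteqP; split=> X h T => [[Tt PT]|PT].
  exact: (h (Thick Tt)).
by apply: h; split=> //; exact: thickP.
Qed.

Lemma partition_subcat_obj P p q : arcpos p q ->
  partition_subcat C a P (obj p q) <-> same_block P p.1 q.1.
Proof.
move=> pq; split=> [h|pqP]; last first.
  move=> T Tc; apply; exists [set e p; e q] => //; exact/partition_arcsE.
apply: contraT => /(separating_thick pq)[U [Ut nU PU]]; case: nU.
by apply: h; [apply: thick_add_closed|apply: partition_arcs_image_sub].
Qed.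

(** * The arcs of a thick subcategory *)

Section ThickArcs.
Variable T : set C.
Hypothesis Tthick : is_thick T.

Definition thick_arc p q : Prop := arcpos p q /\ T (obj p q).

Lemma thick_arcC p q : thick_arc p q -> thick_arc q p.
Proof. by rewrite /thick_arc objC => -[pq ?]; split=> //; move: pq; clear; poslia. Qed.

Lemma thick_arc_shift d p q : thick_arc p q -> thick_arc (shift d p) (shift d q).
Proof.
move=> [pq Tpq]; split; first by rewrite arcpos_shift.
have shift0 r : shift 0 r = r by apply/pos_eq; clear; poslia.
have shiftD c c' r : shift c (shift c' r) = shift (c' + c) r.
  by apply/pos_eq; clear; poslia.
elim: d => [|m IHm|m IHm]; first by rewrite !shift0.
  apply/(thick_susp Tthick); rewrite -addn1 PoszD -!shiftD.
  by apply: (thick_iso Tthick) IHm; apply: obj_desusp; rewrite arcpos_shift.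
rewrite -addn1 PoszD opprD -!shiftD.
have := obj_susp (p := shift (- m%:Z) p) (q := shift (- m%:Z) q).
rewrite arcpos_shift => /(_ pq)/isomorphic_sym/(thick_iso Tthick); apply.
exact/(thick_susp Tthick).
Qed.

(** The side from [p] to [r] is a summand of the middle term of the triangle given by the
    crossing. *)
Lemma thick_arc_cross p q r s : thick_arc p q -> thick_arc r s ->
  cycpos p r q -> cycpos q s p -> arcpos p r -> thick_arc p r.
Proof.
move=> [pq Tpq] [rs Trs] c1 c2 pr; split=> //.
have pq' : is_arc Z [set e p; e q] by apply/is_arcE.
have rs' : is_arc Z [set e r; e s] by apply/is_arcE.
have c4 : cyc4 (e p) (e r) (e q) (e s) by apply/cyc4E; rewrite c1.
have [|phi [phi' phiK _]] := dcc_hom_cross C pq' rs'.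
  by apply/crossE; rewrite /crosspos c1 c2.
have f0 : phi 1 <> 0.
  by rewrite -(raddf0 phi) => /(can_inj phiK)/eqP; apply/negP; exact: oner_neq0.
have [W [i [pi [u [v [dW tr _]]]]]] := dcc_triangle pq' rs' c4 f0.
have [[_ Ts] _ _ _] := Tthick.
apply: (Ts _ _ (dsum_bool_summand true (ex_intro _ i (ex_intro _ pi dW)))).
exact: thick_middle tr _ _.
Qed.

(** [D m] gathers the arcs of length [m.+2]. Such an arc crosses its translate by one, and the sides
    of the two have length one more and one less; hence all lengths from [2] on are reached. *)
Lemma thick_arc_interval_lt i (k l k' l' : int) : k + 1 < l -> k' + 1 < l' ->
  thick_arc (i, k) (i, l) -> thick_arc (i, k') (i, l').
Proof.
pose D m := forall c : int, thick_arc (i, c) (i, c + m.+2%:Z).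
have up m : D m -> D m.+1.
  move=> Dm c; apply/thick_arcC.
  have := Dm (c + 1); have := Dm c => h /thick_arcC/thick_arc_cross/(_ h).
  have -> : c + m.+3%:Z = c + 1 + m.+2%:Z by lia.
  by apply; clear; poslia.
have down m : D m.+1 -> D m.
  move=> Dm c; have := Dm c; have := Dm (c - 1) => /thick_arcC h /thick_arc_cross/(_ h).
  have -> : c + m.+2%:Z = c - 1 + m.+3%:Z by lia.
  by apply; clear; poslia.
have Dlt (b d : int) : b + 1 < d ->
    exists m : nat, forall c : int, c + m.+2%:Z = c + (d - b).
  by move=> bd; exists (absz (d - b - 2)%R) => c; lia.
move=> /Dlt[m1 e1] /Dlt[m2 e2] kl.
have D1 : D m1.
  move=> c; rewrite e1; have := thick_arc_shift (c - k) kl; rewrite /shift /=.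
  have -> : k + (c - k) = c by lia.
  by have -> : l + (c - k) = c + (l - k) by lia.
have D0 : D 0%N by elim: m1 {e1} D1 => // m IHm /down.
have : D m2 by elim: m2 {e2} => // m /up.
by move/(_ k'); rewrite e2; have -> : k' + (l' - k') = l' by lia.
Qed.

Lemma thick_arc_interval i (k l k' l' : int) :
  thick_arc (i, k) (i, l) -> arcpos (i, k') (i, l') -> thick_arc (i, k') (i, l').
Proof.
have lt2 (b d : int) : arcpos (i, b) (i, d) -> b + 1 < d \/ d + 1 < b.
  by rewrite /arcpos /= eqxx /= => /orP.
move=> kl /lt2 h'; have [/lt2 h _] := kl.
case: h h' => h [h'|h'].
- exact: thick_arc_interval_lt h h' kl.
- exact/thick_arcC/(thick_arc_interval_lt h h' kl).
- exact: thick_arc_interval_lt h h' (thick_arcC kl).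
- exact/thick_arcC/(thick_arc_interval_lt h h' (thick_arcC kl)).
Qed.

(** As within one interval, an arc crosses its translate by one; the two sides between the intervals
    change the difference [d] of the integers by one in either direction. *)
Lemma thick_arc_two_intervals i j (k l k' l' : int) : i != j ->
  thick_arc (i, k) (j, l) -> thick_arc (i, k') (j, l').
Proof.
move=> ij kl; have vij : val i != val j by rewrite (inj_eq val_inj).
pose D (d : int) := forall c : int, thick_arc (i, c) (j, c + d).
have up d : D d -> D (d + 1).
  move=> Dd c; apply/thick_arcC.
  have := Dd c; have := Dd (c + 1) => /thick_arcC/thick_arc_cross h /h.
  have -> : c + (d + 1) = c + 1 + d by lia.
  by apply; move: vij; clear; poslia.
have down d : D d -> D (d - 1).
  move=> Dd c; have h := Dd (c - 1); have := Dd c => /thick_arc_cross.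
  move=> /(_ _ _ (thick_arcC h)).
  have -> : c + (d - 1) = c - 1 + d by lia.
  by apply; move: vij; clear; poslia.
have D1 : D (l - k).
  move=> c; have := thick_arc_shift (c - k) kl; rewrite /shift /=.
  have -> : k + (c - k) = c by lia.
  by have -> : l + (c - k) = c + (l - k) by lia.
have DD (m : nat) : D (l - k + m%:Z) /\ D (l - k - m%:Z).
  elim: m => [|m [/up IHm /down IHm']]; first by rewrite !addr0.
  have -> : l - k + m.+1%:Z = l - k + m%:Z + 1 by lia.
  by have -> : l - k - m.+1%:Z = l - k - m%:Z - 1 by lia.
have : D (l' - k').
  have [h1 h2] := DD (absz ((l' - k') - (l - k))%R).
  have [h|h] := leP (l - k) (l' - k').
    by move: h1; congr D; lia.
  by move: h2; congr D; lia.
by move/(_ k'); have -> : k' + (l' - k') = l' by lia.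
Qed.

Definition linked i j : Prop := exists k l : int, thick_arc (i, k) (j, l).

Lemma linkedC i j : linked i j -> linked j i.
Proof. by move=> [k [l /thick_arcC h]]; exists l, k. Qed.

Lemma linked_refl i j : linked i j -> linked i i.
Proof.
have [->//|ij] := eqVneq i j; move=> [k [l kl]]; exists 0, 2.
have vij : val i != val j by rewrite (inj_eq val_inj).
(* The distance [2] in the [i]-th interval makes the side an arc, and the values [0], [1] in the
   [j]-th make the two arcs cross. *)
have := thick_arc_cross (thick_arc_two_intervals 0 0 ij kl)
  (thick_arc_two_intervals 2 1 ij kl).
by apply; move: vij; clear; poslia.
Qed.

Lemma linked_thick_arc p q : arcpos p q -> linked p.1 q.1 -> thick_arc p q.
Proof.
case: p q => [i k'] [j l'] pq /= [k [l]].
have [eij|ij] := eqVneq i j; last exact: thick_arc_two_intervals.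
by subst j => /thick_arc_interval; apply.
Qed.

Lemma linked_trans i j k : linked i j -> linked j k -> linked i k.
Proof.
have [<-//|ij] := eqVneq i j; have [<-//|jk] := eqVneq j k.
move=> ij' jk'; have [ik|ik] := eqVneq i k; first by rewrite -ik; apply: linked_refl ij'.
have [vij vjk vik] : [/\ val i != val j, val j != val k & val i != val k].
  by rewrite !(inj_eq val_inj).
have arcs (c d : int) : thick_arc (i, c) (j, d) /\ thick_arc (k, c) (j, d).
  split; apply: linked_thick_arc => //; rewrite /arcpos /=.
  - by rewrite vij.
  - by rewrite eq_sym vjk.
  - exact: linkedC.
(* Arcs from the two outer intervals to neighbouring points of the [j]-th cross if these points are
   taken in the right order, which depends on the cyclic order of [i], [j], [k]. *)
have [c|c] := boolP (cycpos (i, 0) (j, 0) (k, 0)).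
  exists 0, 0; apply/thick_arcC.
  have := thick_arc_cross (arcs 0 0).2 (arcs 0 1).1.
  by apply; move: vij vjk vik c; clear; poslia.
exists 0, 0; have := thick_arc_cross (arcs 0 0).1 (arcs 0 1).2.
by apply; move: vij vjk vik c; clear; poslia.
Qed.

Lemma linked_noncrossing (i k j l : 'I_n) :
  (i < k)%N -> (k < j)%N -> (j < l)%N -> linked i j -> linked k l -> linked i k.
Proof.
move=> ik kj jl ij kl; exists 0, 0.
have h1 : thick_arc (i, 0) (j, 0).
  by apply: linked_thick_arc => //; rewrite /arcpos /= neq_ltn (ltn_trans ik).
have h2 : thick_arc (k, 0) (l, 0).
  by apply: linked_thick_arc => //; rewrite /arcpos /= neq_ltn (ltn_trans kj).
by apply: (thick_arc_cross h1 h2); move: ik kj jl; clear; poslia.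
Qed.

End ThickArcs.

(** * Thick subcategories correspond to partitions *)

Lemma thick_partition (T : set C) : is_thick T ->
  exists P : nnc n, forall i j, same_block P i j <-> linked T i j.
Proof.
(* [linked] is reflexive only on the set [D] of intervals linked to themselves; the other indices
   belong to no block. *)
move=> Tt; pose r i j := `[< linked T i j >]; pose D := [set i | r i i]%SET.
have rP i j : reflect (linked T i j) (r i j) by apply: asboolP.
have rD i j : r i j -> (i \in D) && (j \in D).
  move=> /rP ij; rewrite !inE; apply/andP; split; apply/rP.
    exact: linked_refl ij.
  exact: linked_refl (linkedC ij).
have req : {in D & &, equivalence_rel r}.
  move=> i j k _ _; rewrite inE => kD; split=> // /rP ij.
  apply/rP/rP; last exact: linked_trans ij.
  by apply: linked_trans; [|apply: linkedC].
have /and3P[/eqP coverD tI n0] := equivalence_partitionP req.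
set Q := equivalence_partition r D in coverD tI n0.
have blkP B i j : B \in Q -> i \in B -> (j \in B) = r i j.
  move=> BQ iB; have iD : i \in D by rewrite -coverD; apply/bigcupP; exists B.
  rewrite -(def_pblock tI BQ iB); have [jD|njD] := boolP (j \in D).
    exact: pblock_equivalence_partition.
  rewrite [RHS](contraNF _ njD); last by case/rD/andP.
  apply: contraNF njD => jB; rewrite -coverD.
  by apply/bigcupP; exists B; rewrite // -(def_pblock tI BQ iB).
have Qnc : noncrossing Q.
  apply/noncrossingP => B1 B2 B1Q B2Q i k j l ik kj jl iB jB kB lB.
  have kB1 : k \in B1.
    rewrite (blkP _ i) //; apply/rP; apply: (linked_noncrossing Tt ik kj jl).
      by apply/rP; rewrite -(blkP B1).
    by apply/rP; rewrite -(blkP B2).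
  by rewrite -(def_pblock tI B1Q kB1) (def_pblock tI B2Q kB).
have Qnnc : is_nnc Q by apply/and3P.
exists (NNC Qnnc) => i j; split=> [/exists_inP[B BQ /andP[iB jB]]|/rP ij].
  by apply/rP; rewrite -(blkP B).
have /andP[iD jD] := rD _ _ ij; move: (iD); rewrite -coverD => /bigcupP[B BQ iB].
by apply/exists_inP; exists B => //; rewrite iB (blkP B i).
Qed.

Lemma partition_subcat_surj (T : set C) : is_thick T ->
  exists P : nnc n, partition_subcat C a P = T.
Proof.
move=> Tt; have [P PT] := thick_partition Tt; exists P; apply/seteqP; split.
  move=> X; apply; first exact: thick_add_closed.
  apply: partition_arcs_image_sub => p q pq /PT.
  by move=> /(linked_thick_arc Tt pq)[].
apply: (krull_schmidt_sub (@tcat_dsums _ C) (@dcc_krull_schmidt _ _ _ C)).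
- exact: thick_add_closed.
- exact: add_hull_closed.
move=> X /obj_surj[p [q [pq Xpq]]] TX.
apply: (add_closed_iso (add_hull_closed _) Xpq).
apply/partition_subcat_obj => //; apply/PT; exists p.2, q.2.
by case: p q pq Xpq => [i k] [j l] pq Xpq; split=> //=;
  apply: (thick_iso Tt) TX; apply: isomorphic_sym.
Qed.

Lemma partition_subcat_sub P Q :
  partition_subcat C a P `<=` partition_subcat C a Q <-> (P <= Q)%O.
Proof.
split=> [PQ|/nnc_leP PQ].
  have blkPQ i j : same_block P i j -> same_block Q i j.
    (* The integers [0] and [2] give an arc even for [i = j], so that arcs also detect which indices
       are covered. *)
    have ij : arcpos (i, 0) (j, 2) by clear; poslia.
    by move=> /(partition_subcat_obj P ij)/PQ/(partition_subcat_obj Q ij).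
  apply/nnc_leP => B BP.
  have /set0Pn[i iB] : B != finset.set0.
    by apply: contraTneq BP => ->; case/and3P: (nncP P).
  have inB j : j \in B -> same_block Q i j.
    by move=> jB; apply: blkPQ; apply/exists_inP; exists B; rewrite // iB jB.
  have /exists_inP[D DQ /andP[iD _]] := inB i iB; exists D => //.
  apply/fintype.subsetP => j /inB/exists_inP[D' D'Q /andP[iD' jD']].
  by rewrite (nnc_block_eq DQ D'Q iD iD').
move=> X hX T Tc QT; apply: hX Tc _; apply: partition_arcs_image_sub => p q pq.
move=> /exists_inP[B BP /andP[pB qB]]; have [D DQ /fintype.subsetP BD] := PQ _ BP.
apply: QT; exists [set e p; e q] => //; apply/partition_arcsE; split=> //.
by apply/exists_inP; exists D; rewrite // !BD.
Qed.

End ArcObjects.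
End ArcCoordinates.

(** * From order isomorphism to lattice isomorphism *)

Lemma order_iso_lmorphism d d' (L : latticeType d) (L' : latticeType d') (f : L -> L') :
  {mono f : x y / (x <= y)%O} -> (forall y, exists x, f x = y) ->
  exists F : {lmorphism L -> L'}, bijective F /\ F =1 f.
Proof.
move=> fmono fsurj.
have fI : {morph f : x y / (x `&` y)%O}.
  move=> x y; have [z ez] := fsurj (f x `&` f y)%O; apply/le_anti/andP; split.
    by rewrite lexI !fmono leIl leIr.
  by rewrite -ez fmono lexI -!fmono ez leIl leIr.
have fU : {morph f : x y / (x `|` y)%O}.
  move=> x y; have [z ez] := fsurj (f x `|` f y)%O; apply/le_anti/andP; split.
    by rewrite -ez fmono leUx -!fmono ez leUl leUr.
  by rewrite leUx !fmono leUl leUr.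
have fhomo : {homo f : x y / (x <= y)%O} by move=> x y; rewrite fmono.
pose om := Order.isOrderMorphism.Build d L d' L' f fhomo.
pose mm := Order.isMeetLatticeMorphism.Build d L d' L' f fI.
pose jm := Order.isJoinLatticeMorphism.Build d L d' L' f fU.
pose F : {lmorphism L -> L'} := HB.pack f om mm jm.
exists F; split=> //; have [g fg] := choice fsurj.
exists g => // x; apply: (inc_inj fmono); exact: fg.
Qed.

Theorem theorem3p7 (R : realType) (Z : set (R * R)) (n : nat)
    (a : 'I_n -> R * R) (hZ : admissible Z a)
    (K : fieldType) (C : discrete_cluster_category Z K) :
  exists F : {lmorphism nnc n -> thick C},
    bijective F /\ forall P : nnc n, thick_set (F P) = partition_subcat C a P.
Proof.
(* There is at least one limit point, and the coordinates are indexed by ['I_n.+1]. *)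
case: n a hZ => [a hZ|n a hZ]; first by have := adm_n_gt0 hZ.
have [e [e_inj ZE IE cycE]] := admissible_coord hZ.
have thP := partition_subcat_thick e_inj ZE cycE C IE.
have [||F [Fbij FE]] := @order_iso_lmorphism _ _ (nnc n.+1) (thick C)
    (fun P => Thick (thP P)).
- move=> P Q; apply/asboolP/idP => [|PQ].
    by move/(partition_subcat_sub e_inj ZE cycE C IE).
  exact/(partition_subcat_sub e_inj ZE cycE C IE).
- move=> T; have [P PT] := partition_subcat_surj e_inj ZE cycE IE (thickP T).
  by exists P; apply/le_anti/andP; split; apply/asboolP; rewrite /= PT.
by exists F; split=> // P; rewrite FE.
Qed.
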